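(* Let $n=1$ and let $\mu\ge 0$, $\nu^2\ge 0$ be constants. Assume $f\in \mathcal{C}^{0,1}_{t,x}([0,\infty)\times\mathbb{R})$, $u_0\in\mathcal{C}^2(\mathbb{R})$ and $u_1\in\mathcal{C}^1(\mathbb{R})$. Then a representation formula for the (classical) solution $u$ of the Cauchy problem $$\begin{cases} u_{tt}-u_{xx}+\frac{\mu}{1+t}u_t+\frac{\nu^2}{(1+t)^2}u=f(t,x), & x\in\mathbb{R},\ t>0,\\ u(0,x)=u_0(x), & x\in\mathbb{R},\\ u_t(0,x)=u_1(x), & x\in\mathbb{R},\end{cases}$$ is given by $$\begin{aligned} u(t,x)&=\tfrac12(1+t)^{-\frac{\mu}{2}}\big(u_0(x+t)+u_0(x-t)\big)+\frac{1}{2^{\sqrt{\delta}}}\int_{x-t}^{x+t}u_0(y)\,K_0(t,x;y;\mu,\nu^2)\,\mathrm{d}y\\ &\quad+\frac{1}{2^{\sqrt{\delta}}}\int_{x-t}^{x+t}\big(u_1(y)+\mu\,u_0(y)\big)K_1(t,x;y;\mu,\nu^2)\,\mathrm{d}y\\ &\quad+\frac{1}{2^{\sqrt{\delta}}}\int_0^t\int_{x-t+b}^{x+t-b}f(b,y)\,E(t,x;b,y;\mu,\nu^2)\,\mathrm{d}y\,\mathrm{d}b,\end{aligned}$$ that is, the function $u$ defined by this formula is the solution of the Cauchy problem.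
   Context: Set $\delta=(\mu-1)^2-4\nu^2$; if $\delta<0$, $\sqrt{\delta}$ means $i\sqrt{-\delta}$, and powers of positive reals with complex exponents are $a^{c}=e^{c\log a}$. $\mathsf{F}(\alpha,\beta;\gamma;z)$ denotes Gauss' hypergeometric function (power series for $|z|<1$). For $t,b\ge 0$ and $x,y\in\mathbb{R}$ (with $|y-x|<t+b+2$), the kernels are $$E(t,x;b,y;\mu,\nu^2)=(1+t)^{-\frac{\mu}{2}+\frac{1-\sqrt{\delta}}{2}}(1+b)^{\frac{\mu}{2}+\frac{1-\sqrt{\delta}}{2}}\big((t+b+2)^2-(y-x)^2\big)^{\frac{\sqrt{\delta}-1}{2}}\,\mathsf{F}\Big(\tfrac{1-\sqrt{\delta}}{2},\tfrac{1-\sqrt{\delta}}{2};1;\tfrac{(t-b)^2-(y-x)^2}{(t+b+2)^2-(y-x)^2}\Big),$$ $$K_0(t,x;y;\mu,\nu^2)=-\frac{\partial}{\partial b}E(t,x;b,y;\mu,\nu^2)\Big|_{b=0},\qquad K_1(t,x;y;\mu,\nu^2)=E(t,x;0,y;\mu,\nu^2).$$ $\mathcal{C}^{0,1}_{t,x}([0,\infty)\times\mathbb{R})$ is the space of continuous functions $f(t,x)$ whose partial derivative $\partial_x f$ exists and is continuous on $[0,\infty)\times\mathbb{R}$. Solutions are understood in the classical (pointwise) sense. *)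

(* Defs.v *)
From Stdlib Require Import Reals Factorial.
From Coquelicot Require Import Coquelicot.
Open Scope R_scope.

Definition Cexp (z : C) : C :=
  (exp (Re z) * cos (Im z), exp (Re z) * sin (Im z)).

(* Meant for a > 0. *)
Definition Rcpow (a : R) (c : C) : C := Cexp (c * RtoC (ln a))%C.

(* Principal complex square root of a real number: i * sqrt (- d) when d < 0. *)
Definition Csqrt (d : R) : C :=
  if Rle_dec 0 d then (sqrt d, 0) else (0, sqrt (- d)).

Fixpoint Cpochhammer (a : C) (n : nat) : C :=
  match n with
  | O => RtoC 1
  | S m => (Cpochhammer a m * (a + RtoC (INR m)))%C
  end.

Definition hyp2F1_coef (al be ga : C) (n : nat) : C :=
  (Cpochhammer al n * Cpochhammer be n
     / (Cpochhammer ga n * RtoC (INR (fact n))))%C.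

(* Complex parameters but real argument, so that the real and imaginary parts
   of the sum are real power series in z.  Meant for |z| < 1. *)
Definition hyp2F1 (al be ga : C) (z : R) : C :=
  (PSeries (fun n => Re (hyp2F1_coef al be ga n)) z,
   PSeries (fun n => Im (hyp2F1_coef al be ga n)) z).

Definition CRInt (g : R -> C) (a b : R) : C :=
  RInt (V := C_R_CompleteNormedModule) g a b.

Definition CDerive (g : R -> C) (s : R) : C :=
  (Derive (fun r => Re (g r)) s, Derive (fun r => Im (g r)) s).

Definition delta (mu nu2 : R) : R := (mu - 1) ^ 2 - 4 * nu2.

Definition kerE (t x b y mu nu2 : R) : C :=
  let sd := Csqrt (delta mu nu2) in
  let al := ((RtoC 1 - sd) / RtoC 2)%C in
  let D := (t + b + 2) ^ 2 - (y - x) ^ 2 in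
  (Rcpow (1 + t) (RtoC (- (mu / 2)) + al)
   * Rcpow (1 + b) (RtoC (mu / 2) + al)
   * Rcpow D ((sd - RtoC 1) / RtoC 2)
   * hyp2F1 al al (RtoC 1) (((t - b) ^ 2 - (y - x) ^ 2) / D))%C.

(* The derivative at b = 0 is two-sided: for |y - x| <= t the formula for E is
   smooth in b on a neighbourhood of 0, so this is also the derivative from
   the right. *)
Definition kerK0 (t x y mu nu2 : R) : C :=
  Copp (CDerive (fun b => kerE t x b y mu nu2) 0).

Definition kerK1 (t x y mu nu2 : R) : C := kerE t x 0 y mu nu2.

(* The right-hand side of the representation formula; a priori complex-valued
   when delta < 0. *)
Definition repr_formula (mu nu2 : R) (f : R -> R -> R) (u0 u1 : R -> R)
    (t x : R) : C :=
  let c := (RtoC 1 / Rcpow 2 (Csqrt (delta mu nu2)))%C in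
  (RtoC (/ 2 * Rpower (1 + t) (- (mu / 2)) * (u0 (x + t)%R + u0 (x - t)%R))%R
   + c * CRInt (fun y => RtoC (u0 y) * kerK0 t x y mu nu2) (x - t) (x + t)
   + c * CRInt (fun y => RtoC (u1 y + mu * u0 y)%R * kerK1 t x y mu nu2)
           (x - t) (x + t)
   + c * CRInt (fun b =>
           CRInt (fun y => RtoC (f b y) * kerE t x b y mu nu2)
             (x - t + b) (x + t - b)) 0 t)%C.

(* Regularity.  Functions on [0, oo) x R are represented by functions on
   R x R whose values at negative times are irrelevant: all limits are taken
   within the closed half plane. *)

Definition is_Ck (k : nat) (g : R -> R) : Prop :=
  forall x, (forall j, (j <= k)%nat -> ex_derive_n g j x) /\
            continuous (Derive_n g k) x.

Definition continuous_half (g : R -> R -> R) : Prop :=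
  forall t x, 0 <= t ->
    filterlim (fun p : R * R => g (fst p) (snd p))
      (within (fun p : R * R => 0 <= fst p) (locally (t, x)))
      (locally (g t x)).

(* One-sided at t = 0, the usual derivative at t > 0. *)
Definition is_derive_t (g : R -> R -> R) (t x l : R) : Prop :=
  filterdiff (fun s : R => g s x)
    (within (fun s : R => 0 <= s) (locally t)) (fun h : R => scal h l).

Definition is_C01_half (f : R -> R -> R) : Prop :=
  continuous_half f /\
  exists fx : R -> R -> R,
    continuous_half fx /\
    forall t x, 0 <= t -> is_derive (fun z => f t z) x (fx t x).

Definition is_C1_half (g gt gx : R -> R -> R) : Prop :=
  continuous_half g /\ continuous_half gt /\ continuous_half gx /\
  forall t x, 0 <= t ->
    is_derive_t g t x (gt t x) /\ is_derive (fun z => g t z) x (gx t x).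

Definition is_C2_half (g gt gx gtt gtx gxt gxx : R -> R -> R) : Prop :=
  is_C1_half g gt gx /\ is_C1_half gt gtt gtx /\ is_C1_half gx gxt gxx.

Definition classical_solution (mu nu2 : R) (f : R -> R -> R) (u0 u1 : R -> R)
    (u : R -> R -> R) : Prop :=
  exists ut ux utt utx uxt uxx : R -> R -> R,
    is_C2_half u ut ux utt utx uxt uxx /\
    (forall t x, 0 < t ->
       utt t x - uxx t x + mu / (1 + t) * ut t x
         + nu2 / (1 + t) ^ 2 * u t x = f t x) /\
    (forall x, u 0 x = u0 x) /\
    (forall x, ut 0 x = u1 x).

(* Main.v *)
Require Import Defs.
From Stdlib Require Import Reals Psatz Factorial ClassicalEpsilon.
From Coquelicot Require Import Coquelicot.
Open Scope R_scope.

(* Put v = (1+t)^(mu/2) u.  Then v_tt - v_xx + la/(1+t)^2 v = (1+t)^(mu/2) f with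
   la = (1 - delta)/4 = al(1 - al), al = (1 - sqrt delta)/2, and the Riemann function
   of this operator is P(s), s = ((t-b)^2-(y-x)^2)/(4(1+t)(1+b)), where
   s(1+s)P'' + (1+2s)P' + la P = 0 and P(0) = 1.  In the variable z = s/(1+s), which
   is the argument of the hypergeometric function, P = (1-z)^al F(al,al;1;z): this
   solves a Fuchsian equation with real coefficients, so its imaginary part, which
   vanishes at z = 0, vanishes identically, also when al is not real.  Hence the
   formula is half of (1+t)^(-mu/2) times a sum of a d'Alembert term, two integrals
   of the data over the characteristic cone and a Duhamel integral of such cone
   integrals, all of which may be differentiated under the integral sign; the
   boundary terms vanish because P is constant along characteristics, and the
   one of the kernel -dP/db cancels the potential acting on the d'Alembert term.
   Uniqueness: in a backward cone, an exponentially weighted bound on w, w_t - w_x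
   and w_t + w_x for the difference w of two solutions improves by a factor 2 when
   the equation is integrated along characteristics. *)

(** * Integrals depending on parameters *)

(** The form of the calculus below is dictated by domains of definition. Leibniz' rule is wanted
    without side conditions, so every integrand should be differentiable for all arguments; but [f]
    is given for t >= 0 only, 1/(1+t) and the powers of 1+t are singular at t = -1, and P is known
    for s >= 0 while s < 0 outside the cone. Each of them is therefore replaced by a global
    extension, and the differential identities are asserted only for t >= 0 inside the cone. Since
    [f] is merely continuous in time, the initial time b of a cone is never differentiated: all
    derivatives of the Duhamel term fall on the kernel or, at the edges of the cone, on [f] in the
    space variable. The coefficient mu in u1 + mu u0 arises as follows. The data of v are u0 and u1
    + (mu/2) u0, while -dE/db also hits the factor (1+b)^(mu/2) of E; this contributes -(mu/2) u0,
    which the second integral has to compensate. *)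

Lemma continuous_slice {U : UniformSpace} (F : U -> R -> R) (u : U) (y : R) :
  continuous (fun p : U * R => F (fst p) (snd p)) (u, y) ->
  continuous (fun z => F u z) y.
Proof.
  intros H.
  apply (continuous_comp_2 (fun _ : R => u) (fun z : R => z) F y).
  - apply continuous_const.
  - apply continuous_id.
  - exact H.
Qed.

(** Compactness of [0,1] makes the neighbourhood of [u0] independent of y. The parameter lives in an
    arbitrary uniform space, so that the same lemma serves for R and for products of R. *)
Lemma tube_continuity {U : UniformSpace} (F : U -> R -> R) (u0 : U) :
  (forall y, continuous (fun p : U * R => F (fst p) (snd p)) (u0, y)) ->
  forall eps : posreal, locally u0 (fun u =>
    forall y, 0 <= y <= 1 -> Rabs (F u y - F u0 y) < eps).
Proof.
  intros HF eps.
  assert (H : forall y, exists d : posreal, forall u y', ball u0 d u ->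
    Rabs (y' - y) < d -> Rabs (F u y' - F u0 y) < eps / 2).
  { intros y.
    destruct (proj1 (filterlim_locally _ _) (HF y) (pos_div_2 eps)) as [d Hd].
    exists d; intros u y' Hu Hy.
    apply (Hd (u, y')); split; simpl; [exact Hu | exact Hy]. }
  pose (delta := fun y => proj1_sig (constructive_indefinite_description _ (H y))).
  assert (Hdelta : forall y u y', ball u0 (delta y) u ->
    Rabs (y' - y) < delta y -> Rabs (F u y' - F u0 y) < eps / 2).
  { intros y; unfold delta; apply proj2_sig. }
  destruct (compactness_value_1d 0 1 delta) as [d Hd].
  exists d; intros u Hu y Hy.
  (* The covering statement provides its centre [y1] only under a double negation. *)
  apply NNPP; intros Hn; apply (Hd y Hy); intros (y1 & Hy1 & Hyy & Hdd).
  apply Hn.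
  assert (h1 := Hdelta y1 u y (ball_le _ _ _ Hdd _ Hu) Hyy).
  assert (h2 := Hdelta y1 u0 y (ball_center _ _) Hyy).
  replace (F u y - F u0 y) with ((F u y - F u0 y1) - (F u0 y - F u0 y1)) by ring.
  apply Rle_lt_trans with (1 := Rabs_triang _ _); rewrite Rabs_Ropp; lra.
Qed.

Lemma ex_RInt_slice {U : UniformSpace} (F : U -> R -> R) (u : U) (a b : R) :
  (forall y, continuous (fun p : U * R => F (fst p) (snd p)) (u, y)) ->
  ex_RInt (fun y => F u y) a b.
Proof.
  intros H; apply (ex_RInt_continuous (V := R_CompleteNormedModule)).
  intros y _; apply continuous_slice, H.
Qed.

Lemma continuous_RInt_param_01 {U : UniformSpace} (F : U -> R -> R) (u0 : U) :
  (forall u y, continuous (fun p : U * R => F (fst p) (snd p)) (u, y)) ->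
  continuous (fun u => RInt (fun y => F u y) 0 1) u0.
Proof.
  intros HF; apply filterlim_locally; intros eps.
  generalize (tube_continuity F u0 (HF u0) (pos_div_2 eps)).
  apply filter_imp; intros u Hu; simpl in Hu.
  assert (e1 := ex_RInt_slice F u 0 1 (HF u)).
  assert (e0 := ex_RInt_slice F u0 0 1 (HF u0)).
  change (Rabs (RInt (fun y => F u y) 0 1 - RInt (fun y => F u0 y) 0 1) < eps).
  assert (E : RInt (fun y => F u y) 0 1 - RInt (fun y => F u0 y) 0 1
     = RInt (fun y => F u y - F u0 y) 0 1)
    by (symmetry; apply (RInt_minus (V := R_CompleteNormedModule)); assumption).
  rewrite E.
  apply Rle_lt_trans with ((1 - 0) * (eps / 2)).
  - apply abs_RInt_le_const; [lra | | ].
    + apply (ex_RInt_minus (V := R_NormedModule)); assumption.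
    + intros y Hy; apply Rlt_le, Hu, Hy.
  - assert (h := cond_pos eps); lra.
Qed.

(** An affine substitution moves the variable bounds into the integrand and leaves an integral over
    [0,1]. *)
Lemma continuous_RInt_param {U : UniformSpace} (F : U -> R -> R) (a b : U -> R) (u0 : U) :
  (forall u y, continuous (fun p : U * R => F (fst p) (snd p)) (u, y)) ->
  (forall u, continuous a u) -> (forall u, continuous b u) ->
  continuous (fun u => RInt (fun y => F u y) (a u) (b u)) u0.
Proof.
  intros HF Ha Hb.
  apply continuous_ext with
    (fun u => RInt (fun s => (b u - a u) * F u ((b u - a u) * s + a u)) 0 1).
  - intros u.
    assert (h := RInt_comp_lin (V := R_CompleteNormedModule) (fun y => F u y)
      (b u - a u) (a u) 0 1 (ex_RInt_slice F u _ _ (HF u))).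
    replace ((b u - a u) * 0 + a u) with (a u) in h by ring.
    replace ((b u - a u) * 1 + a u) with (b u) in h by ring.
    exact h.
  - apply (continuous_RInt_param_01
      (fun u s => (b u - a u) * F u ((b u - a u) * s + a u))).
    intros u s.
    assert (Ca : continuous (fun p : U * R => a (fst p)) (u, s))
      by (apply (continuous_comp fst a); [apply continuous_fst | apply Ha]).
    assert (Cb : continuous (fun p : U * R => b (fst p)) (u, s))
      by (apply (continuous_comp fst b); [apply continuous_fst | apply Hb]).
    assert (Cd : continuous (fun p : U * R => b (fst p) - a (fst p)) (u, s))
      by (apply (continuous_minus (V := R_NormedModule)); assumption).
    apply (continuous_mult (K := R_AbsRing)); [exact Cd |].
    apply (continuous_comp_2 (fun p : U * R => fst p)
      (fun p : U * R => (b (fst p) - a (fst p)) * snd p + a (fst p)) F).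
    + apply continuous_fst.
    + apply (continuous_plus (V := R_NormedModule)); [|exact Ca].
      apply (continuous_mult (K := R_AbsRing)); [exact Cd | apply continuous_snd].
    + apply HF.
Qed.

Lemma continuous_continuity_2d (F : R -> R -> R) (x y : R) :
  continuous (fun p : R * R => F (fst p) (snd p)) (x, y) -> continuity_2d_pt F x y.
Proof. intros H; apply continuity_2d_pt_filterlim. exact H. Qed.

Lemma is_derive_RInt_leibniz (G Gt : R -> R -> R) (a b : R -> R) (t a' b' : R) :
  (forall t y, is_derive (fun z => G z y) t (Gt t y)) ->
  (forall p, continuous (fun p : R * R => G (fst p) (snd p)) p) ->
  (forall p, continuous (fun p : R * R => Gt (fst p) (snd p)) p) ->
  is_derive a t a' -> is_derive b t b' ->
  is_derive (fun z => RInt (fun y => G z y) (a z) (b z)) t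
    (b' * G t (b t) - a' * G t (a t) + RInt (fun y => Gt t y) (a t) (b t)).
Proof.
  intros HD HG HGt Ha Hb.
  assert (Hex : forall t a b, ex_RInt (fun y => G t y) a b)
    by (intros; apply ex_RInt_slice; intros; apply HG).
  assert (HDe : forall t y, Derive (fun z => G z y) t = Gt t y)
    by (intros; apply is_derive_unique, HD).
  assert (HC : forall t y, continuity_2d_pt (fun u v => Derive (fun z => G z v) u) t y).
  { intros t0 y0; apply continuity_2d_pt_ext with Gt.
    - intros; symmetry; apply HDe.
    - apply continuous_continuity_2d, HGt. }
  assert (HCG : forall y, continuity_pt (fun v => G t v) y).
  { intros y; apply continuity_pt_filterlim, (continuous_slice G), HG. }
  replace (b' * G t (b t) - a' * G t (a t) + RInt (fun y => Gt t y) (a t) (b t))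
    with (RInt (fun y => Derive (fun u => G u y) t) (a t) (b t)
          + - G t (a t) * a' + G t (b t) * b').
  2: { rewrite (RInt_ext _ (fun y => Gt t y)) by (intros; apply HDe). ring. }
  apply is_derive_RInt_param_bound_comp; try assumption.
  - apply filter_forall; intros; apply Hex.
  - exists (mkposreal 1 Rlt_0_1); apply filter_forall; intros; apply Hex.
  - exists (mkposreal 1 Rlt_0_1); apply filter_forall; intros; apply Hex.
  - exists (mkposreal 1 Rlt_0_1); apply filter_forall; intros; eexists; apply HD.
  - intros; apply HC.
  - apply locally_2d_forall; intros; apply HC.
  - apply locally_2d_forall; intros; apply HC.
  - apply HCG.
  - apply HCG.
Qed.

(** * A calculus of functions of (t, x) with a parameter *)

(** Joint continuity, phrased as stability under composition with continuous arguments from any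
    uniform space: in this form the tactic [cont] can proceed by the syntax of an expression, also
    when a variable of integration is adjoined to the parameters. *)
Definition cont2 (h : R -> R -> R) : Prop :=
  forall (U : UniformSpace) (b y : U -> R) (u : U),
    continuous b u -> continuous y u -> continuous (fun v => h (b v) (y v)) u.

Definition cont3 (S : R -> R -> R -> R) : Prop :=
  forall (U : UniformSpace) (t x b : U -> R) (u : U),
    continuous t u -> continuous x u -> continuous b u ->
    continuous (fun v => S (t v) (x v) (b v)) u.

Lemma continuous_Rplus {U : UniformSpace} (f g : U -> R) (u : U) :
  continuous f u -> continuous g u -> continuous (fun v => f v + g v) u.
Proof. apply (continuous_plus (V := R_NormedModule)). Qed.

Lemma continuous_Rminus {U : UniformSpace} (f g : U -> R) (u : U) :
  continuous f u -> continuous g u -> continuous (fun v => f v - g v) u.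
Proof. apply (continuous_minus (V := R_NormedModule)). Qed.

Lemma continuous_Ropp {U : UniformSpace} (f : U -> R) (u : U) :
  continuous f u -> continuous (fun v => - f v) u.
Proof. apply (continuous_opp (V := R_NormedModule)). Qed.

Lemma continuous_Rmult {U : UniformSpace} (f g : U -> R) (u : U) :
  continuous f u -> continuous g u -> continuous (fun v => f v * g v) u.
Proof. apply (continuous_mult (K := R_AbsRing)). Qed.

Lemma continuous_Rcomp {U : UniformSpace} (g : R -> R) (f : U -> R) (u : U) :
  (forall z, continuous g z) -> continuous f u -> continuous (fun v => g (f v)) u.
Proof. intros Hg Hf; apply (continuous_comp f g); [exact Hf | apply Hg]. Qed.

Ltac cont :=
  repeat first
    [ assumption
    | match goal with
      | |- continuous (fun _ => _ + _) _ => apply continuous_Rplus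
      | |- continuous (fun _ => _ - _) _ => apply continuous_Rminus
      | |- continuous (fun _ => _ * _) _ => apply continuous_Rmult
      | |- continuous (fun _ => - _) _ => apply continuous_Ropp
      | H : cont3 ?S |- continuous (fun v => ?S _ _ _) _ => apply H
      | H : cont2 ?S |- continuous (fun v => ?S _ _) _ => apply H
      | |- continuous (Rmult ?c) _ => apply (continuous_Rmult (fun _ => c) (fun z => z))
      | H : cont3 ?S |- continuous (?S ?t ?x) ?b => apply (H _ (fun _ => t) (fun _ => x) (fun z => z))
      | H : cont2 ?S |- continuous (?S ?b) ?y => apply (H _ (fun _ => b) (fun z => z))
      | H : forall z, continuous ?g z |- continuous ?g _ => apply H
      | H : forall z, continuous ?g z |- continuous (fun v => ?g _) _ =>
          apply (continuous_Rcomp g _ _ H)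
      end
    | apply continuous_id
    | apply continuous_const
    | apply continuous_fst
    | apply continuous_snd ].

Lemma cont3_prod (S : R -> R -> R -> R) :
  (forall p, continuous (fun p : R * (R * R) => S (fst p) (fst (snd p)) (snd (snd p))) p) ->
  cont3 S.
Proof.
  intros H U t x b u Ht Hx Hb.
  apply (continuous_comp_2 (fun v => t v) (fun v => (x v, b v))
    (fun t (q : R * R) => S t (fst q) (snd q))); [exact Ht | | apply H].
  apply (continuous_comp_2 x b (fun x b => (x, b))); [exact Hx | exact Hb |].
  apply continuous_ext with (fun z => z); [intros [? ?]; reflexivity | apply continuous_id].
Qed.

Lemma cont2_prod (h : R -> R -> R) :
  (forall p, continuous (fun p : R * R => h (fst p) (snd p)) p) -> cont2 h.
Proof.
  intros H U b y u Hb Hy; apply (continuous_comp_2 b y h); [exact Hb | exact Hy | apply H].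
Qed.

(* [St] and [Sx] are the partial derivatives in the first two variables; the
   third one (the initial time [b] of the cone) is a mere parameter. *)
Definition C1p (S St Sx : R -> R -> R -> R) : Prop :=
  (cont3 S /\ cont3 St /\ cont3 Sx) /\
  (forall t x b, is_derive (fun z => S z x b) t (St t x b)) /\
  (forall t x b, is_derive (fun z => S t z b) x (Sx t x b)).

Lemma C1p_intro (S St Sx : R -> R -> R -> R) :
  cont3 S -> cont3 St -> cont3 Sx ->
  (forall t x b, is_derive (fun z => S z x b) t (St t x b)) ->
  (forall t x b, is_derive (fun z => S t z b) x (Sx t x b)) ->
  C1p S St Sx.
Proof. unfold C1p; tauto. Qed.

Lemma C1p_ext (S St Sx S' St' Sx' : R -> R -> R -> R) :
  C1p S St Sx ->
  (forall t x b, S t x b = S' t x b) ->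
  (forall t x b, St t x b = St' t x b) ->
  (forall t x b, Sx t x b = Sx' t x b) ->
  C1p S' St' Sx'.
Proof.
  intros ((H1 & H2 & H3) & H4 & H5) E Et Ex; apply C1p_intro.
  - intros U t x b u ht hx hb; eapply continuous_ext; [intros; apply E | cont].
  - intros U t x b u ht hx hb; eapply continuous_ext; [intros; apply Et | cont].
  - intros U t x b u ht hx hb; eapply continuous_ext; [intros; apply Ex | cont].
  - intros t x b; rewrite <- Et; eapply is_derive_ext; [intros; apply E | apply H4].
  - intros t x b; rewrite <- Ex; eapply is_derive_ext; [intros; apply E | apply H5].
Qed.

Lemma C1p_plus S St Sx T Tt Tx :
  C1p S St Sx -> C1p T Tt Tx ->
  C1p (fun t x b => S t x b + T t x b) (fun t x b => St t x b + Tt t x b)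
      (fun t x b => Sx t x b + Tx t x b).
Proof.
  intros ((H1 & H2 & H3) & H4 & H5) ((G1 & G2 & G3) & G4 & G5); apply C1p_intro;
    try (intros U t x b u ht hx hb; cont).
  - intros t x b; apply (is_derive_plus (V := R_NormedModule) (fun z => S z x b) (fun z => T z x b)); auto.
  - intros t x b; apply (is_derive_plus (V := R_NormedModule) (fun z => S t z b) (fun z => T t z b)); auto.
Qed.

Lemma C1p_opp S St Sx :
  C1p S St Sx ->
  C1p (fun t x b => - S t x b) (fun t x b => - St t x b) (fun t x b => - Sx t x b).
Proof.
  intros ((H1 & H2 & H3) & H4 & H5); apply C1p_intro;
    try (intros U t x b u ht hx hb; cont).
  - intros; apply (is_derive_opp (V := R_NormedModule)); auto.
  - intros; apply (is_derive_opp (V := R_NormedModule)); auto.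
Qed.

Lemma C1p_mult S St Sx T Tt Tx :
  C1p S St Sx -> C1p T Tt Tx ->
  C1p (fun t x b => S t x b * T t x b)
      (fun t x b => St t x b * T t x b + S t x b * Tt t x b)
      (fun t x b => Sx t x b * T t x b + S t x b * Tx t x b).
Proof.
  intros ((H1 & H2 & H3) & H4 & H5) ((G1 & G2 & G3) & G4 & G5); apply C1p_intro;
    try (intros U t x b u ht hx hb; cont).
  - intros t x b; apply (is_derive_mult (K := R_AbsRing) (fun z => S z x b) (fun z => T z x b)); auto; intros; apply Rmult_comm.
  - intros t x b; apply (is_derive_mult (K := R_AbsRing) (fun z => S t z b) (fun z => T t z b)); auto; intros; apply Rmult_comm.
Qed.

Lemma C1p_comp (g g' : R -> R) S St Sx :
  (forall z, is_derive g z (g' z)) -> (forall z, continuous g' z) ->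
  C1p S St Sx ->
  C1p (fun t x b => g (S t x b)) (fun t x b => St t x b * g' (S t x b))
      (fun t x b => Sx t x b * g' (S t x b)).
Proof.
  intros Hg Hg' ((H1 & H2 & H3) & H4 & H5).
  assert (Hgc : forall z, continuous g z).
  { intros z; apply (ex_derive_continuous (V := R_NormedModule)); eexists; apply Hg. }
  apply C1p_intro; try (intros U t x b u ht hx hb; cont).
  - intros t x b; apply (is_derive_comp (K := R_AbsRing) (V := R_NormedModule) g); auto.
  - intros t x b; apply (is_derive_comp (K := R_AbsRing) (V := R_NormedModule) g); auto.
Qed.

Lemma C1p_param (g : R -> R) :
  (forall z, continuous g z) ->
  C1p (fun t x b => g b) (fun t x b => 0) (fun t x b => 0).
Proof.
  intros Hg; apply C1p_intro; try (intros U t x b u ht hx hb; cont).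
  - intros; apply (is_derive_const (V := R_NormedModule)).
  - intros; apply (is_derive_const (V := R_NormedModule)).
Qed.

Lemma C1p_const (c : R) : C1p (fun t x b => c) (fun t x b => 0) (fun t x b => 0).
Proof. apply (C1p_param (fun _ => c)); intros; apply continuous_const. Qed.

Lemma C1p_time (g g' : R -> R) :
  (forall z, is_derive g z (g' z)) -> (forall z, continuous g' z) ->
  C1p (fun t x b => g t) (fun t x b => g' t) (fun t x b => 0).
Proof.
  intros Hg Hg'.
  assert (Hgc : forall z, continuous g z).
  { intros z; apply (ex_derive_continuous (V := R_NormedModule)); eexists; apply Hg. }
  apply C1p_intro; try (intros U t x b u ht hx hb; cont).
  - intros; apply Hg.
  - intros; apply (is_derive_const (V := R_NormedModule)).
Qed.

(** With c = 1 or -1 the point x + c(t-b) is the foot at time b of a characteristic through (t,x).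
    Moving (t,x) moves the foot in space only, hence [h] is differentiated in its second argument
    alone. *)
Lemma C1p_char (h hy : R -> R -> R) (c : R) :
  cont2 h -> cont2 hy -> (forall b y, is_derive (fun z => h b z) y (hy b y)) ->
  C1p (fun t x b => h b (x + c * (t - b))) (fun t x b => c * hy b (x + c * (t - b)))
      (fun t x b => hy b (x + c * (t - b))).
Proof.
  intros H1 H2 H3; apply C1p_intro; try (intros U t x b u ht hx hb; cont).
  - intros t x b.
    apply (is_derive_comp (K := R_AbsRing) (V := R_NormedModule) (fun z => h b z)
      (fun z => x + c * (z - b))); [apply H3 |].
    auto_derive; [exact I | ring].
  - intros t x b.
    replace (hy b (x + c * (t - b))) with (scal 1 (hy b (x + c * (t - b)))) by apply Rmult_1_l.
    apply (is_derive_comp (K := R_AbsRing) (V := R_NormedModule) (fun z => h b z)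
      (fun z => z + c * (t - b))); [apply H3 |].
    auto_derive; [exact I | ring].
Qed.

Lemma is_derive_comp_2 (F Fx Fy : R -> R -> R) (a b : R -> R) (s a' b' : R) :
  locally (a s, b s) (fun p : R * R =>
    is_derive (fun z => F z (snd p)) (fst p) (Fx (fst p) (snd p))) ->
  is_derive (fun z => F (a s) z) (b s) (Fy (a s) (b s)) ->
  continuous (fun p : R * R => Fx (fst p) (snd p)) (a s, b s) ->
  is_derive a s a' -> is_derive b s b' ->
  is_derive (fun z => F (a z) (b z)) s (a' * Fx (a s) (b s) + b' * Fy (a s) (b s)).
Proof.
  intros HFx HFy HC Ha Hb.
  assert (HD := is_derive_filterdiff F (a s) (b s) Fx (Fy (a s) (b s)) HFx HFy HC).
  assert (H := filterdiff_comp'_2 a b F s _ _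
    (fun u v => plus (scal u (Fx (a s) (b s))) (scal v (Fy (a s) (b s)))) Ha Hb HD).
  unfold is_derive.
  eapply filterdiff_ext_lin; [apply H |].
  intros y; unfold scal, plus; simpl; unfold mult; simpl; ring.
Qed.

(** On the edge r = c(t-b) of the cone a kernel depends on t and b only. Its time derivative Q_t + c
    Q_r is the derivative along the characteristic, which vanishes for the Riemann function. *)
Lemma C1p_edge (Q Qt Qr : R -> R -> R -> R) (c : R) :
  C1p Q Qt Qr ->
  C1p (fun t x b => Q t (c * (t - b)) b)
      (fun t x b => Qt t (c * (t - b)) b + c * Qr t (c * (t - b)) b)
      (fun t x b => 0).
Proof.
  intros ((H1 & H2 & H3) & H4 & H5); apply C1p_intro;
    try (intros U t x b u ht hx hb; cont).
  - intros t x b.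
    replace (Qt t (c * (t - b)) b + c * Qr t (c * (t - b)) b) with
      (1 * Qt t (c * (t - b)) b + c * Qr t (c * (t - b)) b) by ring.
    apply (is_derive_comp_2 (fun t r => Q t r b) (fun t r => Qt t r b)
      (fun t r => Qr t r b) (fun t => t) (fun t => c * (t - b))).
    + apply filter_forall; intros p; apply H4.
    + apply H5.
    + cont.
    + apply (is_derive_id (K := R_AbsRing)).
    + auto_derive; [exact I | ring].
  - intros; apply (is_derive_const (V := R_NormedModule)).
Qed.

(** Integral over the base, at time b, of the backward cone with apex (t,x). The kernel sees space
    only through r = y - x, so an x-derivative of it is minus an r-derivative. *)
Definition cone (h : R -> R -> R) (Q : R -> R -> R -> R) (t x b : R) : R :=
  RInt (fun y => h b y * Q t (y - x) b) (x - (t - b)) (x + (t - b)).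

Lemma cont3_cone h Q : cont2 h -> cont3 Q -> cont3 (cone h Q).
Proof.
  intros Hh HQ; apply cont3_prod; intros p; unfold cone.
  assert (C1 : forall p : R * (R * R), continuous (fun v : R * (R * R) => fst (snd v)) p).
  { intros q; apply (continuous_comp snd fst); [apply continuous_snd | apply continuous_fst]. }
  assert (C2 : forall p : R * (R * R), continuous (fun v : R * (R * R) => snd (snd v)) p).
  { intros q; apply (continuous_comp snd snd); [apply continuous_snd | apply continuous_snd]. }
  apply (continuous_RInt_param (fun (p : R * (R * R)) y =>
    h (snd (snd p)) y * Q (fst p) (y - fst (snd p)) (snd (snd p)))).
  - intros u y.
    assert (D : continuous (fun v : R * (R * R) * R => fst v) (u, y)) by apply continuous_fst.
    assert (D0 : continuous (fun v : R * (R * R) * R => fst (fst v)) (u, y))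
      by (apply (continuous_comp fst fst); [exact D | apply continuous_fst]).
    assert (D1 : continuous (fun v : R * (R * R) * R => fst (snd (fst v))) (u, y))
      by (apply (continuous_comp fst (fun q => fst (snd q))); [exact D | apply C1]).
    assert (D2 : continuous (fun v : R * (R * R) * R => snd (snd (fst v))) (u, y))
      by (apply (continuous_comp fst (fun q => snd (snd q))); [exact D | apply C2]).
    cont.
  - intros u; specialize (C1 u); specialize (C2 u); cont.
  - intros u; specialize (C1 u); specialize (C2 u); cont.
Qed.

Lemma cone_opp h Q t x b : cont2 h -> cont3 Q ->
  RInt (fun y => - (h b y * Q t (y - x) b)) (x - (t - b)) (x + (t - b)) = - cone h Q t x b.
Proof.
  intros Hh HQ; apply (RInt_opp (V := R_CompleteNormedModule)
    (fun y => h b y * Q t (y - x) b)).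
  apply (ex_RInt_continuous (V := R_CompleteNormedModule)); intros y _; cont.
Qed.

(** Leibniz' rule, with one boundary term for each edge of the cone. The factors 1 and -1 are kept
    explicit so that both edges are instances of the same expression in c, which is differentiated
    once more afterwards. *)
Lemma C1p_cone h Q Qt Qr :
  cont2 h -> C1p Q Qt Qr ->
  C1p (cone h Q)
    (fun t x b => h b (x + 1 * (t - b)) * Q t (1 * (t - b)) b
       + h b (x + (-1) * (t - b)) * Q t ((-1) * (t - b)) b + cone h Qt t x b)
    (fun t x b => h b (x + 1 * (t - b)) * Q t (1 * (t - b)) b
       + - (h b (x + (-1) * (t - b)) * Q t ((-1) * (t - b)) b) + - cone h Qr t x b).
Proof.
  intros Hh ((H1 & H2 & H3) & H4 & H5).
  assert (K0 := cont3_cone h Q Hh H1).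
  assert (K1 := cont3_cone h Qt Hh H2).
  assert (K2 := cont3_cone h Qr Hh H3).
  apply C1p_intro; try (intros U t x b u ht hx hb; cont).
  - intros t x b.
    assert (L := is_derive_RInt_leibniz (fun t y => h b y * Q t (y - x) b)
      (fun t y => h b y * Qt t (y - x) b) (fun t => x - (t - b)) (fun t => x + (t - b))
      t (-1) 1).
    unfold cone at 1.
    replace (h b (x + 1 * (t - b)) * Q t (1 * (t - b)) b
       + h b (x + (-1) * (t - b)) * Q t ((-1) * (t - b)) b + cone h Qt t x b) with
      (1 * (h b (x + (t - b)) * Q t (x + (t - b) - x) b)
       - (-1) * (h b (x - (t - b)) * Q t (x - (t - b) - x) b)
       + RInt (fun y => h b y * Qt t (y - x) b) (x - (t - b)) (x + (t - b))).
    + apply L.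
      * intros; apply is_derive_scal, H4.
      * intros p; cont.
      * intros p; cont.
      * auto_derive; [exact I | ring].
      * auto_derive; [exact I | ring].
    + unfold cone.
      replace (x + (t - b) - x) with (1 * (t - b)) by ring.
      replace (x - (t - b) - x) with ((-1) * (t - b)) by ring.
      replace (x + (t - b)) with (x + 1 * (t - b)) by ring.
      replace (x - (t - b)) with (x + (-1) * (t - b)) by ring.
      ring.
  - intros t x b.
    assert (L := is_derive_RInt_leibniz (fun x y => h b y * Q t (y - x) b)
      (fun x y => - (h b y * Qr t (y - x) b)) (fun x => x - (t - b)) (fun x => x + (t - b))
      x 1 1).
    unfold cone at 1.
    replace (h b (x + 1 * (t - b)) * Q t (1 * (t - b)) b
       + - (h b (x + (-1) * (t - b)) * Q t ((-1) * (t - b)) b) + - cone h Qr t x b) with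
      (1 * (h b (x + (t - b)) * Q t (x + (t - b) - x) b)
       - 1 * (h b (x - (t - b)) * Q t (x - (t - b) - x) b)
       + RInt (fun y => - (h b y * Qr t (y - x) b)) (x - (t - b)) (x + (t - b))).
    + apply L.
      * intros x' y.
        replace (- (h b y * Qr t (y - x') b)) with (h b y * (-1 * Qr t (y - x') b)) by ring.
        apply is_derive_scal.
        apply (is_derive_comp (K := R_AbsRing) (V := R_NormedModule)
          (fun r => Q t r b) (fun z => y - z)); [apply H5 |].
        auto_derive; [exact I | ring].
      * intros p; cont.
      * intros p; cont.
      * auto_derive; [exact I | ring].
      * auto_derive; [exact I | ring].
    + rewrite cone_opp by assumption.
      replace (x + (t - b) - x) with (1 * (t - b)) by ring.
      replace (x - (t - b) - x) with ((-1) * (t - b)) by ring.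
      replace (x + (t - b)) with (x + 1 * (t - b)) by ring.
      replace (x - (t - b)) with (x + (-1) * (t - b)) by ring.
      ring.
Qed.

(** The third argument is a dummy: it makes the result again a function of three variables, to which
    [C1p] applies. *)
Definition duhamel (S : R -> R -> R -> R) (t x _ : R) : R := RInt (fun b => S t x b) 0 t.

Lemma cont3_duhamel S : cont3 S -> cont3 (duhamel S).
Proof.
  intros HS; apply cont3_prod; intros p; unfold duhamel.
  assert (C1 : forall p : R * (R * R), continuous (fun v : R * (R * R) => fst (snd v)) p).
  { intros q; apply (continuous_comp snd fst); [apply continuous_snd | apply continuous_fst]. }
  apply (continuous_RInt_param (fun (p : R * (R * R)) b => S (fst p) (fst (snd p)) b)
    (fun _ => 0) (fun p => fst p)).
  - intros u y.
    assert (D : continuous (fun v : R * (R * R) * R => fst v) (u, y)) by apply continuous_fst.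
    assert (D0 : continuous (fun v : R * (R * R) * R => fst (fst v)) (u, y))
      by (apply (continuous_comp fst fst); [exact D | apply continuous_fst]).
    assert (D1 : continuous (fun v : R * (R * R) * R => fst (snd (fst v))) (u, y))
      by (apply (continuous_comp fst (fun q => fst (snd q))); [exact D | apply C1]).
    cont.
  - intros u; cont.
  - intros u; cont.
Qed.

Lemma C1p_duhamel S St Sx :
  C1p S St Sx ->
  C1p (duhamel S) (fun t x b => S t x t + duhamel St t x b) (duhamel Sx).
Proof.
  intros ((H1 & H2 & H3) & H4 & H5).
  assert (K0 := cont3_duhamel S H1).
  assert (K1 := cont3_duhamel St H2).
  assert (K2 := cont3_duhamel Sx H3).
  apply C1p_intro; try (intros U t x b u ht hx hb; cont).
  - intros t x b; unfold duhamel.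
    replace (S t x t) with (1 * S t x t - 0 * S t x 0) by ring.
    apply (is_derive_RInt_leibniz (fun t b => S t x b) (fun t b => St t x b)
      (fun _ => 0) (fun t => t)).
    + intros; apply H4.
    + intros p; cont.
    + intros p; cont.
    + apply (is_derive_const (V := R_NormedModule)).
    + apply (is_derive_id (K := R_AbsRing)).
  - intros t x b; unfold duhamel.
    replace (RInt (fun b => Sx t x b) 0 t) with
      (0 * S t x t - 0 * S t x 0 + RInt (fun b => Sx t x b) 0 t) by ring.
    apply (is_derive_RInt_leibniz (fun x b => S t x b) (fun x b => Sx t x b)
      (fun _ => 0) (fun _ => t)).
    + intros; apply H5.
    + intros p; cont.
    + intros p; cont.
    + apply (is_derive_const (V := R_NormedModule)).
    + apply (is_derive_const (V := R_NormedModule)).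
Qed.

(** * Extension from the half line *)

Lemma continuous_nonneg_part : forall z, continuous (fun z => Rmax z 0) z.
Proof.
  intros z; apply continuous_ext with (fun z => (z + Rabs z) / 2).
  - intros y; change ((y + Rabs y) / 2 = Rmax y 0); unfold Rmax; destruct (Rle_dec y 0).
    + rewrite Rabs_left1 by lra; field.
    + rewrite Rabs_pos_eq by lra; field.
  - apply continuous_Rmult; [|apply continuous_const].
    apply continuous_Rplus; [apply continuous_id | apply continuous_Rabs].
Qed.

(** The extension is F(0) plus the integral of a continuous extension of F'. On the half line its
    difference with F has zero derivative and vanishes at 0. *)
Lemma antiderivative_extension (F F' G' : R -> R) :
  (forall x, 0 <= x -> is_derive F x (F' x)) ->
  (forall x, continuous G' x) ->
  (forall x, 0 <= x -> G' x = F' x) ->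
  exists G, (forall x, is_derive G x (G' x)) /\ (forall x, 0 <= x -> G x = F x).
Proof.
  intros HF HG E.
  assert (DI : forall x, is_derive (fun y => RInt G' 0 y) x (G' x)).
  { intros x; apply (is_derive_RInt (V := R_NormedModule) G' (RInt G' 0) 0 x); [|apply HG].
    apply filter_forall; intros y.
    apply (RInt_correct (V := R_CompleteNormedModule)).
    apply (ex_RInt_continuous (V := R_CompleteNormedModule)); intros; apply HG. }
  exists (fun x => F 0 + RInt G' 0 x); split.
  - intros x; replace (G' x) with (0 + G' x) by ring.
    apply (is_derive_plus (V := R_NormedModule)); [|apply DI].
    apply (is_derive_const (V := R_NormedModule)).
  - intros x Hx.
    assert (D : forall y, 0 <= y -> is_derive (fun y => F y - RInt G' 0 y) y 0).
    { intros y Hy.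
      assert (D := is_derive_minus (V := R_NormedModule) F _ y _ _ (HF y Hy) (DI y)).
      rewrite E in D by exact Hy.
      rewrite (minus_eq_zero ) in D; exact D. }
    destruct (MVT_gen (fun y => F y - RInt G' 0 y) 0 x (fun y => 0)) as [c [_ Hc]].
    1,2: rewrite Rmin_left, Rmax_right by lra.
    + intros y Hy; apply D; lra.
    + intros y Hy; apply continuity_pt_filterlim.
      apply (ex_derive_continuous (V := R_NormedModule) (fun y => F y - RInt G' 0 y)).
      exists 0; apply D; lra.
    + assert (h0 : RInt G' 0 0 = 0) by apply (RInt_point (V := R_CompleteNormedModule)).
      rewrite h0 in Hc; lra.
Qed.

Definition continuous_from_0 (F : R -> R) : Prop :=
  forall z, continuous (fun x => F (Rmax x 0)) z.

Lemma continuous_from_0_of (F : R -> R) :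
  (forall z, 0 <= z -> continuous F z) -> continuous_from_0 F.
Proof.
  intros H z; apply (continuous_comp (fun x => Rmax x 0) F).
  - apply continuous_nonneg_part.
  - apply H, Rmax_r.
Qed.

(** Only the highest derivative is extended by hand, by its value at 0; the lower ones follow by
    integration. For negative arguments the extension is thus the Taylor polynomial of F at 0. *)
Lemma C2_extension (F F1 F2 : R -> R) :
  (forall x, 0 <= x -> is_derive F x (F1 x)) ->
  (forall x, 0 <= x -> is_derive F1 x (F2 x)) ->
  (forall x, 0 <= x -> continuous F2 x) ->
  exists G G1 G2 : R -> R,
    (forall x, is_derive G x (G1 x)) /\ (forall x, is_derive G1 x (G2 x)) /\
    (forall x, continuous G2 x) /\
    (forall x, 0 <= x -> G x = F x /\ G1 x = F1 x /\ G2 x = F2 x).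
Proof.
  intros H H1 H2.
  assert (C2 := continuous_from_0_of F2 H2).
  destruct (antiderivative_extension F1 F2 (fun x => F2 (Rmax x 0)) H1 C2) as [G1 [D1 E1]].
  { intros x Hx; rewrite Rmax_left; auto. }
  assert (C1 : forall x, continuous G1 x).
  { intros x; apply (ex_derive_continuous (V := R_NormedModule)); eexists; apply D1. }
  destruct (antiderivative_extension F F1 G1 H C1 E1) as [G [D E]].
  exists G, G1, (fun x => F2 (Rmax x 0)); split; [exact D |]; split; [exact D1 |].
  split; [exact C2 |]; intros x Hx; rewrite Rmax_left by exact Hx; auto.
Qed.

Lemma C3_extension (F F1 F2 F3 : R -> R) :
  (forall x, 0 <= x -> is_derive F x (F1 x)) ->
  (forall x, 0 <= x -> is_derive F1 x (F2 x)) ->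
  (forall x, 0 <= x -> is_derive F2 x (F3 x)) ->
  (forall x, 0 <= x -> continuous F3 x) ->
  exists G G1 G2 G3 : R -> R,
    (forall x, is_derive G x (G1 x)) /\ (forall x, is_derive G1 x (G2 x)) /\
    (forall x, is_derive G2 x (G3 x)) /\ (forall x, continuous G3 x) /\
    (forall x, 0 <= x -> G x = F x /\ G1 x = F1 x /\ G2 x = F2 x /\ G3 x = F3 x).
Proof.
  intros H H1 H2 H3.
  destruct (C2_extension F1 F2 F3 H1 H2 H3) as (G1 & G2 & G3 & D1 & D2 & C3 & E).
  assert (C1 : forall x, continuous G1 x).
  { intros x; apply (ex_derive_continuous (V := R_NormedModule)); eexists; apply D1. }
  destruct (antiderivative_extension F F1 G1 H C1) as [G [D E0]].
  { intros; apply E; auto. }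
  exists G, G1, G2, G3; split; [exact D |]; split; [exact D1 |]; split; [exact D2 |].
  split; [exact C3 |]; intros x Hx; split; [apply E0; auto | apply E; auto].
Qed.

(** * Wave operators of cone integrals *)

Definition C2p (S St Sx Stt Stx Sxt Sxx : R -> R -> R -> R) : Prop :=
  C1p S St Sx /\ C1p St Stt Stx /\ C1p Sx Sxt Sxx.

Lemma C1p_slice S St Sx :
  C1p S St Sx ->
  C1p (fun t x _ => S t x 0) (fun t x _ => St t x 0) (fun t x _ => Sx t x 0).
Proof.
  intros ((H1 & H2 & H3) & H4 & H5); apply C1p_intro;
    try (intros U t x b u ht hx hb; cont).
  - intros; apply H4.
  - intros; apply H5.
Qed.

Definition edge (h : R -> R -> R) (Q : R -> R -> R -> R) (c t x b : R) : R :=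
  h b (x + c * (t - b)) * Q t (c * (t - b)) b.

Lemma C1p_edge_term h hy Q Qt Qr c :
  cont2 h -> cont2 hy -> (forall b y, is_derive (fun z => h b z) y (hy b y)) ->
  C1p Q Qt Qr ->
  C1p (edge h Q c)
    (fun t x b => c * edge hy Q c t x b + (edge h Qt c t x b + c * edge h Qr c t x b))
    (edge hy Q c).
Proof.
  intros H1 H2 H3 HQ.
  assert (T := C1p_mult _ _ _ _ _ _ (C1p_char h hy c H1 H2 H3) (C1p_edge Q Qt Qr c HQ)).
  apply (C1p_ext _ _ _ _ _ _ T); unfold edge; intros; ring.
Qed.

Lemma RInt_zero_combination (A B C : R -> R) (c l r : R) :
  (forall b, continuous A b) -> (forall b, continuous B b) -> (forall b, continuous C b) ->
  l <= r -> (forall b, l < b < r -> A b - B b + c * C b = 0) ->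
  RInt A l r - RInt B l r + c * RInt C l r = 0.
Proof.
  intros HA HB HC Hlr H.
  assert (X : forall K, (forall b, continuous K b) -> ex_RInt (V := R_NormedModule) K l r).
  { intros K HK; apply (ex_RInt_continuous (V := R_CompleteNormedModule)); intros y _; apply HK. }
  assert (Y1 := is_RInt_minus (V := R_NormedModule) _ _ _ _ _ _
    (RInt_correct (V := R_CompleteNormedModule) _ _ _ (X _ HA))
    (RInt_correct (V := R_CompleteNormedModule) _ _ _ (X _ HB))).
  assert (Y2 := is_RInt_scal (V := R_NormedModule) _ _ _ c _
    (RInt_correct (V := R_CompleteNormedModule) _ _ _ (X _ HC))).
  assert (Y := is_RInt_plus (V := R_NormedModule) _ _ _ _ _ _ Y1 Y2).
  assert (Z := is_RInt_const (V := R_NormedModule) l r 0).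
  apply (is_RInt_ext _ (fun _ => 0)) in Y.
  - apply (is_RInt_unique (V := R_CompleteNormedModule)) in Y.
    apply (is_RInt_unique (V := R_CompleteNormedModule)) in Z.
    transitivity (RInt (V := R_CompleteNormedModule) (fun _ => 0) l r);
      [symmetry; exact Y | rewrite Z; apply Rmult_0_r].
  - intros b; rewrite Rmin_left, Rmax_right by lra; intros Hb.
    rewrite <- (H b Hb); unfold minus, plus, scal, opp; simpl; unfold mult; simpl; ring.
Qed.

Lemma RInt_cone_combination h Qtt Qrr Q c t x b :
  cont2 h -> cont3 Qtt -> cont3 Qrr -> cont3 Q -> 0 <= t - b ->
  (forall r, Rabs r <= t - b -> Qtt t r b - Qrr t r b + c * Q t r b = 0) ->
  cone h Qtt t x b - cone h Qrr t x b + c * cone h Q t x b = 0.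
Proof.
  intros Hh H1 H2 H3 Htb HPDE; apply RInt_zero_combination;
    [intros y; cont | intros y; cont | intros y; cont | lra |].
  intros y Hy.
  transitivity (h b y * (Qtt t (y - x) b - Qrr t (y - x) b + c * Q t (y - x) b)); [ring |].
  rewrite HPDE; [ring | apply Rabs_le; lra].
Qed.

Lemma cone_diag h Q t x : cone h Q t x t = 0.
Proof.
  unfold cone; replace (x - (t - t)) with x by ring; replace (x + (t - t)) with x by ring.
  apply (RInt_point (V := R_CompleteNormedModule)).
Qed.

Lemma edge_diag h Q c t x : edge h Q c t x t = h t x * Q t 0 t.
Proof.
  unfold edge; replace (c * (t - t)) with 0 by ring; rewrite Rplus_0_r; reflexivity.
Qed.

(** In S_tt - S_xx the edge terms containing h_y cancel, the interior integrals combine into the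
    equation of the kernel, and what remains on the edges is twice h (Q_t + c Q_r), c = 1 and -1.
    The values on the diagonal t = b are the initial data of the cone integral, needed for Duhamel's
    principle and for the initial velocity. *)
Lemma C2p_cone h hy Q Qt Qr Qtt Qtr Qrt Qrr :
  cont2 h -> cont2 hy -> (forall b y, is_derive (fun z => h b z) y (hy b y)) ->
  C2p Q Qt Qr Qtt Qtr Qrt Qrr ->
  exists St Sx Stt Stx Sxt Sxx : R -> R -> R -> R,
    C2p (cone h Q) St Sx Stt Stx Sxt Sxx /\
    (forall t x, St t x t = 2 * (h t x * Q t 0 t)) /\
    (forall t x, Sx t x t = 0) /\
    (forall t x b c, 0 <= t - b ->
      (forall r, Rabs r <= t - b -> Qtt t r b - Qrr t r b + c * Q t r b = 0) ->
      Stt t x b - Sxx t x b + c * cone h Q t x b =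
        2 * (edge h Qt 1 t x b + edge h Qr 1 t x b)
        + 2 * (edge h Qt (-1) t x b - edge h Qr (-1) t x b)).
Proof.
  intros Hh Hhy Hd (HQ & HQt & HQr).
  assert (S0 := C1p_cone h Q Qt Qr Hh HQ).
  assert (ST := C1p_cone h Qt Qtt Qtr Hh HQt).
  assert (SR := C1p_cone h Qr Qrt Qrr Hh HQr).
  assert (Ep := C1p_edge_term h hy Q Qt Qr 1 Hh Hhy Hd HQ).
  assert (Em := C1p_edge_term h hy Q Qt Qr (-1) Hh Hhy Hd HQ).
  assert (T := C1p_plus _ _ _ _ _ _ (C1p_plus _ _ _ _ _ _ Ep Em) ST).
  assert (X := C1p_plus _ _ _ _ _ _ (C1p_plus _ _ _ _ _ _ Ep (C1p_opp _ _ _ Em))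
     (C1p_opp _ _ _ SR)).
  do 6 eexists; split; [split; [exact S0 | split; [exact T | exact X]] |].
  split; [|split]; simpl.
  - intros t x; cbv beta.
    change (edge h Q 1 t x t + edge h Q (-1) t x t + cone h Qt t x t = 2 * (h t x * Q t 0 t)).
    rewrite !edge_diag, cone_diag; ring.
  - intros t x; cbv beta.
    change (edge h Q 1 t x t + - edge h Q (-1) t x t + - cone h Qr t x t = 0).
    rewrite !edge_diag, cone_diag; ring.
  - intros t x b c Htb HPDE; cbv beta.
    assert (K := RInt_cone_combination h Qtt Qrr Q c t x b Hh
      (proj1 (proj2 (proj1 HQt))) (proj2 (proj2 (proj1 HQr))) (proj1 (proj1 HQ)) Htb HPDE).
    fold (edge h Qt 1 t x b) (edge h Qt (-1) t x b).
    fold (edge h Qr 1 t x b) (edge h Qr (-1) t x b).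
    replace (cone h Qtt t x b) with (cone h Qrr t x b - c * cone h Q t x b) by lra.
    ring.
Qed.

(** Of the boundary terms at b = t only S_t survives, because S and S_x vanish there. It enters the
    second time derivative undifferentiated and becomes the source term. *)
Lemma C2p_duhamel S St Sx Stt Stx Sxt Sxx (g : R -> R -> R) :
  C2p S St Sx Stt Stx Sxt Sxx -> cont2 g ->
  (forall t x, S t x t = 0) -> (forall t x, Sx t x t = 0) ->
  (forall t x, St t x t = g t x) ->
  C2p (duhamel S) (duhamel St) (duhamel Sx)
      (fun t x b => g t x + duhamel Stt t x b) (duhamel Stx) (duhamel Sxt) (duhamel Sxx).
Proof.
  intros (H0 & H1 & H2) Hg E Ex Et; split; [|split].
  - apply (C1p_ext _ _ _ _ _ _ (C1p_duhamel _ _ _ H0)); intros; try reflexivity.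
    rewrite E; ring.
  - apply (C1p_ext _ _ _ _ _ _ (C1p_duhamel _ _ _ H1)); intros; try reflexivity.
    rewrite Et; ring.
  - apply (C1p_ext _ _ _ _ _ _ (C1p_duhamel _ _ _ H2)); intros; try reflexivity.
    rewrite Ex; ring.
Qed.

(** * Riemann kernels *)

Ltac real_ring := match goal with |- ?a = ?b => change (@eq R a b); ring end.

Ltac derive_ring := intros; auto_derive; [exact I | real_ring].

Lemma C2p_plus S St Sx Stt Stx Sxt Sxx T Tt Tx Ttt Ttx Txt Txx :
  C2p S St Sx Stt Stx Sxt Sxx -> C2p T Tt Tx Ttt Ttx Txt Txx ->
  C2p (fun t x b => S t x b + T t x b)
    (fun t x b => St t x b + Tt t x b) (fun t x b => Sx t x b + Tx t x b)
    (fun t x b => Stt t x b + Ttt t x b) (fun t x b => Stx t x b + Ttx t x b)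
    (fun t x b => Sxt t x b + Txt t x b) (fun t x b => Sxx t x b + Txx t x b).
Proof.
  intros (H & H1 & H2) (G & G1 & G2); split; [|split]; apply C1p_plus; assumption.
Qed.

Lemma C2p_mult S St Sx Stt Stx Sxt Sxx T Tt Tx Ttt Ttx Txt Txx :
  C2p S St Sx Stt Stx Sxt Sxx -> C2p T Tt Tx Ttt Ttx Txt Txx ->
  C2p (fun t x b => S t x b * T t x b)
    (fun t x b => St t x b * T t x b + S t x b * Tt t x b)
    (fun t x b => Sx t x b * T t x b + S t x b * Tx t x b)
    (fun t x b => Stt t x b * T t x b + St t x b * Tt t x b
       + (St t x b * Tt t x b + S t x b * Ttt t x b))
    (fun t x b => Stx t x b * T t x b + St t x b * Tx t x b
       + (Sx t x b * Tt t x b + S t x b * Ttx t x b))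
    (fun t x b => Sxt t x b * T t x b + Sx t x b * Tt t x b
       + (St t x b * Tx t x b + S t x b * Txt t x b))
    (fun t x b => Sxx t x b * T t x b + Sx t x b * Tx t x b
       + (Sx t x b * Tx t x b + S t x b * Txx t x b)).
Proof.
  intros (H & H1 & H2) (G & G1 & G2); split; [|split].
  - apply C1p_mult; assumption.
  - apply (C1p_plus _ _ _ _ _ _ (C1p_mult _ _ _ _ _ _ H1 G) (C1p_mult _ _ _ _ _ _ H G1)).
  - apply (C1p_plus _ _ _ _ _ _ (C1p_mult _ _ _ _ _ _ H2 G) (C1p_mult _ _ _ _ _ _ H G2)).
Qed.

Lemma C2p_comp (g g1 g2 : R -> R) S St Sx Stt Stx Sxt Sxx :
  (forall z, is_derive g z (g1 z)) -> (forall z, is_derive g1 z (g2 z)) ->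
  (forall z, continuous g2 z) ->
  C2p S St Sx Stt Stx Sxt Sxx ->
  C2p (fun t x b => g (S t x b))
    (fun t x b => St t x b * g1 (S t x b))
    (fun t x b => Sx t x b * g1 (S t x b))
    (fun t x b => Stt t x b * g1 (S t x b) + St t x b * (St t x b * g2 (S t x b)))
    (fun t x b => Stx t x b * g1 (S t x b) + St t x b * (Sx t x b * g2 (S t x b)))
    (fun t x b => Sxt t x b * g1 (S t x b) + Sx t x b * (St t x b * g2 (S t x b)))
    (fun t x b => Sxx t x b * g1 (S t x b) + Sx t x b * (Sx t x b * g2 (S t x b))).
Proof.
  intros Hg Hg1 Hg2 (H & H1 & H2).
  assert (C1 : forall z, continuous g1 z).
  { intros z; apply (ex_derive_continuous (V := R_NormedModule)); eexists; apply Hg1. }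
  assert (K := C1p_comp g1 g2 _ _ _ Hg1 Hg2 H).
  split; [apply C1p_comp; assumption | split].
  - apply (C1p_mult _ _ _ _ _ _ H1 K).
  - apply (C1p_mult _ _ _ _ _ _ H2 K).
Qed.

Lemma C2p_param (g : R -> R) :
  (forall z, continuous g z) ->
  C2p (fun t x b => g b) (fun t x b => 0) (fun t x b => 0)
    (fun t x b => 0) (fun t x b => 0) (fun t x b => 0) (fun t x b => 0).
Proof. intros H; split; [apply C1p_param, H | split; apply C1p_const]. Qed.

Lemma C2p_time (g g1 g2 : R -> R) :
  (forall z, is_derive g z (g1 z)) -> (forall z, is_derive g1 z (g2 z)) ->
  (forall z, continuous g2 z) ->
  C2p (fun t x b => g t) (fun t x b => g1 t) (fun t x b => 0)
    (fun t x b => g2 t) (fun t x b => 0) (fun t x b => 0) (fun t x b => 0).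
Proof.
  intros H H1 H2; split; [|split; [|apply C1p_const]]; apply C1p_time; try assumption.
  intros z; apply (ex_derive_continuous (V := R_NormedModule)); eexists; apply H1.
Qed.

Lemma C2p_dalembert (g g1 g2 : R -> R) :
  (forall z, is_derive g z (g1 z)) -> (forall z, is_derive g1 z (g2 z)) ->
  (forall z, continuous g2 z) ->
  C2p (fun t x b => g (x + t) + g (x - t))
    (fun t x b => g1 (x + t) - g1 (x - t)) (fun t x b => g1 (x + t) + g1 (x - t))
    (fun t x b => g2 (x + t) + g2 (x - t)) (fun t x b => g2 (x + t) - g2 (x - t))
    (fun t x b => g2 (x + t) - g2 (x - t)) (fun t x b => g2 (x + t) + g2 (x - t)).
Proof.
  intros H H1 H2.
  assert (Hp : forall g g1 : R -> R, (forall z, is_derive g z (g1 z)) -> (forall z, continuous g1 z) ->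
    C1p (fun t x b => g (x + t)) (fun t x b => g1 (x + t)) (fun t x b => g1 (x + t)) /\
    C1p (fun t x b => g (x - t)) (fun t x b => - g1 (x - t)) (fun t x b => g1 (x - t))).
  { clear; intros g g1 H H1.
    assert (Ap : C1p (fun t x b => x + t) (fun t x b => 1) (fun t x b => 1)).
    { apply C1p_intro; try (intros U t x b u ht hx hb; cont);
        derive_ring. }
    assert (Am : C1p (fun t x b => x - t) (fun t x b => -1) (fun t x b => 1)).
    { apply C1p_intro; try (intros U t x b u ht hx hb; cont);
        derive_ring. }
    split.
    - apply (C1p_ext _ _ _ _ _ _ (C1p_comp g g1 _ _ _ H H1 Ap)); intros; real_ring.
    - apply (C1p_ext _ _ _ _ _ _ (C1p_comp g g1 _ _ _ H H1 Am)); intros; real_ring. }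
  assert (C1 : forall z, continuous g1 z).
  { intros z; apply (ex_derive_continuous (V := R_NormedModule)); eexists; apply H1. }
  destruct (Hp g g1 H C1) as [P0 M0]; destruct (Hp g1 g2 H1 H2) as [P1 M1].
  split; [|split].
  - apply (C1p_ext _ _ _ _ _ _ (C1p_plus _ _ _ _ _ _ P0 M0)); intros; real_ring.
  - apply (C1p_ext _ _ _ _ _ _ (C1p_plus _ _ _ _ _ _ P1 (C1p_opp _ _ _ M1))); intros; real_ring.
  - apply (C1p_ext _ _ _ _ _ _ (C1p_plus _ _ _ _ _ _ P1 M1)); intros; real_ring.
Qed.

Lemma C2p_quadratic (A B C : R) :
  C2p (fun t r b => A * (t * t) + B * t - r * r + C * (t * b) + b * b)
    (fun t r b => 2 * A * t + B + C * b) (fun t r b => - 2 * r)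
    (fun t r b => 2 * A) (fun t r b => 0) (fun t r b => 0) (fun t r b => - 2).
Proof.
  split; [|split]; apply C1p_intro; try (intros U t x b u ht hx hb; cont);
    derive_ring.
Qed.

(* [k] stands for [1/(1+t)], extended to a function on the whole line. *)
Definition is_inverse_extension (k k1 k2 : R -> R) : Prop :=
  (forall z, is_derive k z (k1 z)) /\ (forall z, is_derive k1 z (k2 z)) /\
  (forall z, continuous k2 z) /\
  (forall z, 0 <= z -> k z = / (1 + z) /\ k1 z = - / (1 + z) ^ 2 /\ k2 z = 2 / (1 + z) ^ 3).

Lemma inverse_extension_exists : exists k k1 k2, is_inverse_extension k k1 k2.
Proof.
  apply C2_extension.
  - intros x Hx; auto_derive; [lra | field; lra].
  - intros x Hx; auto_derive; [nra | field; lra].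
  - intros x Hx; apply (ex_derive_continuous (V := R_NormedModule) (fun z => 2 / (1 + z) ^ 3)).
    auto_derive; assert (0 < (1 + x) ^ 3) by (apply pow_lt; lra); simpl in *; lra.
Qed.

Lemma power_extension_exists (a : R) : exists q q1 q2 : R -> R,
  (forall z, is_derive q z (q1 z)) /\ (forall z, is_derive q1 z (q2 z)) /\
  (forall z, continuous q2 z) /\
  (forall z, 0 <= z -> q z = Rpower (1 + z) a /\ q1 z = a / (1 + z) * Rpower (1 + z) a /\
     q2 z = a * (a - 1) / (1 + z) ^ 2 * Rpower (1 + z) a).
Proof.
  apply C2_extension; unfold Rpower.
  - intros x Hx; auto_derive; [lra | field; lra].
  - intros x Hx; auto_derive; [lra | field; lra].
  - intros x Hx; apply (ex_derive_continuous (V := R_NormedModule)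
      (fun z => a * (a - 1) / (1 + z) ^ 2 * exp (a * ln (1 + z)))).
    auto_derive; split; [|lra]; assert (0 < (1 + x) ^ 2) by (apply pow_lt; lra); simpl in *; lra.
Qed.

(* [P] solves the Legendre-type equation satisfied by the Riemann function as a
   function of [s = ((t-b)^2-r^2)/(4(1+t)(1+b))]; the last identity is the
   derivative of the equation. *)
Definition is_riemann_profile (la : R) (P P1 P2 P3 : R -> R) : Prop :=
  (forall z, is_derive P z (P1 z)) /\ (forall z, is_derive P1 z (P2 z)) /\
  (forall z, is_derive P2 z (P3 z)) /\ (forall z, continuous P3 z) /\ P 0 = 1 /\
  (forall s, 0 <= s -> s * (1 + s) * P2 s + (1 + 2 * s) * P1 s + la * P s = 0) /\
  (forall s, 0 <= s ->
     s * (1 + s) * P3 s + 2 * (1 + 2 * s) * P2 s + (2 + la) * P1 s = 0).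

(** [Q] is P(s), and [H] at b = 0 is -dP(s)/db, as ds/db = (r^2 - 2t - t^2)/(4(1+t)) there. The
    potential la/(1+t)^2 does not involve b, so [H] satisfies the same wave equation as [Q]; this
    costs the third derivative of P. On the edges r = c t one has s = 0 and H = -la t/(2(1+t)),
    whose time derivative is the last identity. *)
Lemma riemann_kernels la P P1 P2 P3 k k1 k2 :
  is_riemann_profile la P P1 P2 P3 -> is_inverse_extension k k1 k2 ->
  exists Q Qt Qr Qtt Qtr Qrt Qrr H Ht Hr Htt Htr Hrt Hrr,
    C2p Q Qt Qr Qtt Qtr Qrt Qrr /\ C2p H Ht Hr Htt Htr Hrt Hrr /\
    (forall t r b, 0 <= t -> 0 <= b ->
       Q t r b = P (((t - b) ^ 2 - r ^ 2) / (4 * (1 + t) * (1 + b)))) /\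
    (forall t r, 0 <= t ->
       H t r 0 = - P1 ((t ^ 2 - r ^ 2) / (4 * (1 + t)))
                 * ((r ^ 2 - 2 * t - t ^ 2) / (4 * (1 + t)))) /\
    (forall t b r, 0 <= t -> 0 <= b -> Rabs r <= t - b ->
       Qtt t r b - Qrr t r b + la / (1 + t) ^ 2 * Q t r b = 0) /\
    (forall t r, 0 <= t -> Rabs r <= t - 0 ->
       Htt t r 0 - Hrr t r 0 + la / (1 + t) ^ 2 * H t r 0 = 0) /\
    (forall t b c, c * c = 1 -> Qt t (c * (t - b)) b + c * Qr t (c * (t - b)) b = 0) /\
    (forall t c, 0 <= t -> c * c = 1 ->
       Ht t (c * (t - 0)) 0 + c * Hr t (c * (t - 0)) 0 = - la / 2 / (1 + t) ^ 2).
Proof.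
  intros (D0 & D1 & D2 & C3 & HP0 & ODE & ODE') (K0 & K1 & K2 & Kpos).
  assert (C2 : forall z, continuous P2 z).
  { intros z; apply (ex_derive_continuous (V := R_NormedModule)); eexists; apply D2. }
  assert (Ck : forall z, continuous k z).
  { intros z; apply (ex_derive_continuous (V := R_NormedModule)); eexists; apply K0. }
  assert (Kt := C2p_time k k1 k2 K0 K1 K2).
  assert (Kb : forall z, continuous (fun b => k b / 4) z).
  { intros z; apply (continuous_Rmult (U := R_UniformSpace) k (fun _ => / 4)).
    - apply Ck. - apply continuous_const. }
  (* The quadratic is (t-b)^2 - r^2, so [Sg] describes s. *)
  assert (Sg := C2p_mult _ _ _ _ _ _ _ _ _ _ _ _ _ _ (C2p_quadratic 1 0 (-2))
    (C2p_mult _ _ _ _ _ _ _ _ _ _ _ _ _ _ Kt (C2p_param _ Kb))).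
  assert (Q := C2p_comp P P1 P2 _ _ _ _ _ _ _ D0 D1 C2 Sg).
  assert (Q' := C2p_comp P1 P2 P3 _ _ _ _ _ _ _ D1 D2 C3 Sg).
  assert (C4 : forall z : R, continuous (fun b : R => / 4) z) by (intros; apply continuous_const).
  (* At b = 0 this is (t^2 + 2t - r^2)/(4(1+t)) = -ds/db. *)
  assert (Sb := C2p_mult _ _ _ _ _ _ _ _ _ _ _ _ _ _ (C2p_quadratic 1 2 0)
    (C2p_mult _ _ _ _ _ _ _ _ _ _ _ _ _ _ Kt (C2p_param _ C4))).
  assert (H := C2p_mult _ _ _ _ _ _ _ _ _ _ _ _ _ _ Q' Sb).
  do 14 eexists; split; [exact Q | split; [exact H |]].
  cbv beta.
  split; [|split; [|split; [|split; [|split]]]].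
  - intros t r b Ht Hb; destruct (Kpos t Ht) as (-> & _); destruct (Kpos b Hb) as (-> & _).
    f_equal; field; lra.
  - intros t r Ht; destruct (Kpos t Ht) as (-> & _);
      destruct (Kpos 0 (Rle_refl 0)) as (-> & _).
    match goal with |- P1 ?a * ?b = - P1 ?c * ?d => replace c with a by (field; lra) end.
    field; lra.
  - intros t b r Ht Hb Hr; destruct (Kpos t Ht) as (-> & -> & ->).
    destruct (Kpos b Hb) as (-> & _).
    match goal with |- context [P ?s] => set (sv := s) end.
    assert (Hs : sv = ((t - b) ^ 2 - r ^ 2) / (4 * (1 + t) * (1 + b)))
      by (unfold sv; field; lra).
    assert (Hsp : 0 <= sv).
    { rewrite Hs; apply Rdiv_le_0_compat; [|nra]. apply Rabs_le_between in Hr; nra. }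
    assert (O := ODE sv Hsp).
    clearbody sv.
    (* The identities behind this are (1+t)^2 (s_t^2 - s_r^2) = s(1+s) and (1+t)^2 (s_tt - s_rr) = 1
       + 2s. *)
    transitivity ((sv * (1 + sv) * P2 sv + (1 + 2 * sv) * P1 sv + la * P sv) / (1 + t) ^ 2).
    + generalize (P sv) (P1 sv) (P2 sv); intros p p1 p2; rewrite Hs; field; lra.
    + rewrite O; field; lra.
  - intros t r Ht Hr; destruct (Kpos t Ht) as (-> & -> & ->).
    destruct (Kpos 0 (Rle_refl 0)) as (-> & _).
    match goal with |- context [P1 ?s] => set (sv := s) end.
    assert (Hs : sv = (t ^ 2 - r ^ 2) / (4 * (1 + t)))
      by (unfold sv; field; lra).
    assert (Hsp : 0 <= sv).
    { rewrite Hs; apply Rdiv_le_0_compat; [|nra]. apply Rabs_le_between in Hr; nra. }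
    assert (O := ODE' sv Hsp).
    clearbody sv.
    transitivity ((- (r ^ 2 - 2 * t - t ^ 2) / (4 * (1 + t))) * - 
      (sv * (1 + sv) * P3 sv + 2 * (1 + 2 * sv) * P2 sv + (2 + la) * P1 sv) * -1 / (1 + t) ^ 2).
    + generalize (P1 sv) (P2 sv) (P3 sv); intros p1 p2 p3; rewrite Hs.
      field; lra.
    + rewrite O; field; lra.
  - intros t b c Hc.
    generalize (P1 ((1 * (t * t) + 0 * t - c * (t - b) * (c * (t - b)) + -2 * (t * b) + b * b) *
   (k t * (k b / 4)))); intros p.
    transitivity ((c * c - 1) * p * (k b / 4) * (- k1 t * (t - b) ^ 2 - 2 * (t - b) * k t)).
    + ring.
    + rewrite Hc; ring.
  - intros t c Ht Hc; destruct (Kpos t Ht) as (-> & -> & _).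
    destruct (Kpos 0 (Rle_refl 0)) as (-> & _).
    match goal with |- context [P1 ?s] => replace s with 0 end.
    2:{ transitivity ((1 - c * c) * (t * t) * (/ (1 + t) * (/ (1 + 0) / 4))).
        - rewrite Hc; ring. - ring. }
    (* At the singular point s = 0 the equation degenerates and forces P'(0) = -la P(0) = -la. *)
    assert (O := ODE 0 (Rle_refl 0)); rewrite HP0 in O.
    replace (P1 0) with (- la) by lra.
    generalize (P2 0); intros p2.
    destruct (Rmult_integral (c - 1) (c + 1)) as [E | E]; [lra | |].
    + replace c with 1 by lra; field; lra.
    + replace c with (-1) by lra; field; lra.
Qed.

(** * Existence *)

Lemma within_half_line_proper (t : R) :
  0 <= t -> ProperFilter (within (fun s : R => 0 <= s) (locally t)).
Proof.
  intros Ht; constructor.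
  - intros P HP; exists t; apply (locally_singleton _ _ HP Ht).
  - apply within_filter, locally_filter.
Qed.

Lemma is_derive_t_of_is_derive (g : R -> R -> R) (t x l : R) :
  0 <= t -> is_derive (fun s => g s x) t l -> is_derive_t g t x l.
Proof.
  intros Ht [L D]; split; [exact L |].
  intros y Hy eps.
  assert (E : y = t).
  { apply (is_filter_lim_unique (F := within (fun s : R => 0 <= s) (locally t))
      (FF := Proper_StrongProper _ (within_half_line_proper t Ht)) y t Hy).
    intros P HP; apply (filter_le_within (F := locally t)); exact HP. }
  subst y.
  apply (filter_le_within (F := locally t)), (D t (fun P H => H)).
Qed.

Lemma continuous_half_of_cont3 (S : R -> R -> R -> R) (b : R) :
  cont3 S -> continuous_half (fun t x => S t x b).
Proof.
  intros HS t x _.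
  apply (filterlim_filter_le_1 _ (filter_le_within (F := locally (t, x)) _)).
  change (continuous (fun p : R * R => S (fst p) (snd p) b) (t, x)); cont.
Qed.

Lemma is_C1_half_of_C1p S St Sx b :
  C1p S St Sx ->
  is_C1_half (fun t x => S t x b) (fun t x => St t x b) (fun t x => Sx t x b).
Proof.
  intros ((H1 & H2 & H3) & H4 & H5).
  split; [apply continuous_half_of_cont3, H1 |].
  split; [apply continuous_half_of_cont3, H2 |].
  split; [apply continuous_half_of_cont3, H3 |].
  intros t x Ht; split; [apply is_derive_t_of_is_derive; [exact Ht | apply H4] | apply H5].
Qed.

(** The map (b,y) -> (max(b,0), y) is continuous with values in the closed half plane, where limits
    within the half plane are all that is required. *)
Lemma cont2_half_extension (f : R -> R -> R) :
  continuous_half f -> cont2 (fun b y => f (Rmax b 0) y).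
Proof.
  intros Hf; apply cont2_prod; intros [b y].
  apply (filterlim_comp _ _ _ (fun p : R * R => (Rmax (fst p) 0, snd p))
    (fun p : R * R => f (fst p) (snd p)) (locally (b, y))
    (within (fun p : R * R => 0 <= fst p) (locally (Rmax b 0, y)))).
  2: apply (Hf (Rmax b 0) y), Rmax_r.
  intros P HP.
  assert (C : continuous (fun p : R * R => (Rmax (fst p) 0, snd p)) (b, y)).
  { apply (continuous_comp_2 (fun p : R * R => Rmax (fst p) 0) (fun p : R * R => snd p)
      (fun u v => (u, v))).
    - apply (continuous_comp fst (fun z => Rmax z 0));
        [apply continuous_fst | apply continuous_nonneg_part].
    - apply continuous_snd.
    - apply continuous_ext with (fun z => z); [intros [? ?]; reflexivity | apply continuous_id]. }
  change (locally (b, y) (fun p : R * R => P (Rmax (fst p) 0, snd p))).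
  assert (CP := C _ HP); unfold filtermap in CP; revert CP.
  apply filter_imp; intros p Hp; apply Hp; simpl; apply Rmax_r.
Qed.

Lemma C2p_slice S St Sx Stt Stx Sxt Sxx :
  C2p S St Sx Stt Stx Sxt Sxx ->
  C2p (fun t x _ => S t x 0) (fun t x _ => St t x 0) (fun t x _ => Sx t x 0)
    (fun t x _ => Stt t x 0) (fun t x _ => Stx t x 0)
    (fun t x _ => Sxt t x 0) (fun t x _ => Sxx t x 0).
Proof. intros (H & H1 & H2); split; [|split]; apply C1p_slice; assumption. Qed.

Lemma is_Ck_1 (g : R -> R) : is_Ck 1 g ->
  (forall z, is_derive g z (Derive g z)) /\ (forall z, continuous (Derive g) z).
Proof.
  intros H; split; intros z; destruct (H z) as [H1 H2].
  - apply Derive_correct, (H1 1%nat), le_n.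
  - exact H2.
Qed.

Lemma is_Ck_2 (g : R -> R) : is_Ck 2 g ->
  (forall z, is_derive g z (Derive g z)) /\
  (forall z, is_derive (Derive g) z (Derive (Derive g) z)) /\
  (forall z, continuous (Derive (Derive g)) z).
Proof.
  intros H; split; [|split]; intros z; destruct (H z) as [H1 H2].
  - apply Derive_correct, (H1 1%nat); auto.
  - apply Derive_correct, (H1 2%nat), le_n.
  - exact H2.
Qed.

(** The real Cauchy problem for an abstract profile P; here nu2 + mu/2 - mu^2/4 is (1 - delta)/4.
    The kernels and the weight [w] are handed out with their continuity and their values for
    nonnegative times, which is what the comparison with the complex kernels needs. *)
Lemma cauchy_existence mu nu2 f u0 u1 P P1 P2 P3 :
  is_riemann_profile (nu2 + mu / 2 - mu ^ 2 / 4) P P1 P2 P3 ->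
  is_C01_half f -> is_Ck 2 u0 -> is_Ck 1 u1 ->
  exists (u : R -> R -> R) (Q H : R -> R -> R -> R) (w : R -> R),
    classical_solution mu nu2 f u0 u1 u /\ cont3 Q /\ cont3 H /\
    (forall z, continuous w z) /\
    (forall t r b, 0 <= t -> 0 <= b ->
       Q t r b = P (((t - b) ^ 2 - r ^ 2) / (4 * (1 + t) * (1 + b)))) /\
    (forall t r, 0 <= t ->
       H t r 0 = - P1 ((t ^ 2 - r ^ 2) / (4 * (1 + t)))
                 * ((r ^ 2 - 2 * t - t ^ 2) / (4 * (1 + t)))) /\
    (forall b, 0 <= b -> w b = Rpower (1 + b) (mu / 2)) /\
    (forall t x, 0 <= t -> u t x = / 2 * Rpower (1 + t) (- (mu / 2)) *
       (u0 (x + t) + u0 (x - t) + cone (fun _ => u0) H t x 0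
        + cone (fun _ y => u1 y + mu / 2 * u0 y) Q t x 0
        + duhamel (cone (fun b y => w b * f (Rmax b 0) y) Q) t x 0)).
Proof.
  set (la := nu2 + mu / 2 - mu ^ 2 / 4).
  intros HP (Cf & fx & Cfx & Hfx) Hu0 Hu1.
  destruct (is_Ck_2 _ Hu0) as (D0 & D0' & C0''); destruct (is_Ck_1 _ Hu1) as (D1 & C1').
  destruct inverse_extension_exists as (k & k1 & k2 & Hk).
  destruct (riemann_kernels la P P1 P2 P3 k k1 k2 HP Hk)
    as (Q & Qt & Qr & Qtt & Qtr & Qrt & Qrr & H & Ht & Hr & Htt & Htr & Hrt & Hrr &
        CQ & CH & EQ & EH & PQ & PH & BQ & BH).
  destruct (power_extension_exists (mu / 2)) as (w & w1 & w2 & Dw & _ & _ & Ew).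
  destruct (power_extension_exists (- (mu / 2))) as (q & q1 & q2 & Dq & Dq1 & Cq2 & Eq).
  assert (Cw : forall z, continuous w z).
  { intros z; apply (ex_derive_continuous (V := R_NormedModule)); eexists; apply Dw. }
  assert (C0 : forall z, continuous u0 z).
  { intros z; apply (ex_derive_continuous (V := R_NormedModule)); eexists; apply D0. }
  assert (C0' : forall z, continuous (Derive u0) z).
  { intros z; apply (ex_derive_continuous (V := R_NormedModule)); eexists; apply D0'. }
  assert (C1 : forall z, continuous u1 z).
  { intros z; apply (ex_derive_continuous (V := R_NormedModule)); eexists; apply D1. }
  (* Source of the equation for v. *)
  set (g := fun b y : R => w b * f (Rmax b 0) y).
  assert (Cfm := cont2_half_extension f Cf). assert (Cfxm := cont2_half_extension fx Cfx).
  assert (Cg : cont2 g).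
  { intros U b y p Hb Hy; unfold g; apply continuous_Rmult; [cont | apply Cfm; assumption]. }
  assert (Cgy : cont2 (fun b y => w b * fx (Rmax b 0) y)).
  { intros U b y p Hb Hy; apply continuous_Rmult; [cont | apply Cfxm; assumption]. }
  assert (Dg : forall b y, is_derive (fun z => g b z) y (w b * fx (Rmax b 0) y)).
  { intros b y; apply is_derive_scal, Hfx, Rmax_r. }
  (* Initial velocity of v = (1+t)^(mu/2) u. *)
  set (v1 := fun y : R => u1 y + mu / 2 * u0 y).
  assert (Dv1 : forall y, is_derive v1 y (Derive u1 y + mu / 2 * Derive u0 y)).
  { intros y; apply (is_derive_plus (V := R_NormedModule)); [apply D1 |].
    apply is_derive_scal, D0. }
  destruct (C2p_cone (fun _ => u0) (fun _ => Derive u0) H Ht Hr Htt Htr Hrt Hrr)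
    as (At & Ax & Att & Atx & Axt & Axx & CA & At0 & _ & WA); try assumption.
  { intros U b y p Hb Hy; cont. } { intros U b y p Hb Hy; cont. } { intros _; apply D0. }
  destruct (C2p_cone (fun _ => v1) (fun _ y => Derive u1 y + mu / 2 * Derive u0 y)
      Q Qt Qr Qtt Qtr Qrt Qrr)
    as (Bt & Bx & Btt & Btx & Bxt & Bxx & CB & Bt0 & _ & WB); try assumption.
  { intros U b y p Hb Hy; unfold v1; cont. } { intros U b y p Hb Hy; cont. }
  { intros _; apply Dv1. }
  destruct (C2p_cone g _ Q Qt Qr Qtt Qtr Qrt Qrr Cg Cgy Dg CQ)
    as (St & Sx & Stt & Stx & Sxt & Sxx & CS & St0 & Sx0 & WS).
  assert (CQ0 : cont3 Q) by apply CQ. assert (CH0 : cont3 H) by apply CH.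
  assert (CG : cont2 (fun t x => 2 * (g t x * Q t 0 t))).
  { intros U b y p Hb Hy; cont. }
  assert (CD := C2p_duhamel _ _ _ _ _ _ _ _ CS CG (cone_diag g Q) Sx0 St0).
  assert (CV := C2p_plus _ _ _ _ _ _ _ _ _ _ _ _ _ _ (C2p_plus _ _ _ _ _ _ _ _ _ _ _ _ _ _
    (C2p_plus _ _ _ _ _ _ _ _ _ _ _ _ _ _ (C2p_dalembert _ _ _ D0 D0' C0'')
       (C2p_slice _ _ _ _ _ _ _ CA)) (C2p_slice _ _ _ _ _ _ _ CB)) CD).
  assert (Chalf : forall z : R, continuous (fun b : R => / 2) z)
    by (intros; apply continuous_const).
  assert (CU := C2p_mult _ _ _ _ _ _ _ _ _ _ _ _ _ _ (C2p_param _ Chalf)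
    (C2p_mult _ _ _ _ _ _ _ _ _ _ _ _ _ _ (C2p_time _ _ _ Dq Dq1 Cq2) CV)).
  assert (WD : forall t x, 0 <= t ->
     duhamel Stt t x 0 - duhamel Sxx t x 0
       + la / (1 + t) ^ 2 * duhamel (cone g Q) t x 0 = 0).
  { intros t x Htp; unfold duhamel.
    destruct CS as (CS0 & CS1 & CS2).
    assert (X1 : cont3 Stt) by apply CS1. assert (X2 : cont3 Sxx) by apply CS2.
    assert (X3 : cont3 (cone g Q)) by apply CS0.
    apply RInt_zero_combination;
      [intros b; cont | intros b; cont | intros b; cont | exact Htp |].
    (* Inside the cone the kernel equation removes the interior integrals; the edge terms vanish
       because [Q] is constant along characteristics. *)
    intros b Hb; rewrite (WS t x b) by (try lra; intros; apply PQ; lra).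
    unfold edge.
    assert (e1 := BQ t b 1 ltac:(ring)). assert (e2 := BQ t b (-1) ltac:(ring)).
    replace (Qt t (1 * (t - b)) b) with (- Qr t (1 * (t - b)) b) by lra.
    replace (Qt t (-1 * (t - b)) b) with (Qr t (-1 * (t - b)) b) by lra.
    ring. }
  assert (WA' : forall t x, 0 <= t ->
     Att t x 0 - Axx t x 0 + la / (1 + t) ^ 2 * cone (fun _ => u0) H t x 0
     = - la / (1 + t) ^ 2 * (u0 (x + t) + u0 (x - t))).
  { intros t x Htp; rewrite (WA t x 0) by (try lra; intros; apply PH; lra).
    unfold edge.
    (* Each edge contributes 2 (-la/2)/(1+t)^2 times the value of [u0] at its foot: exactly what
       cancels the potential applied to the d'Alembert term. *)
    assert (e1 := BH t 1 Htp ltac:(ring)). assert (e2 := BH t (-1) Htp ltac:(ring)).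
    replace (Ht t (1 * (t - 0)) 0) with (- la / 2 / (1 + t) ^ 2 - Hr t (1 * (t - 0)) 0) by lra.
    replace (Ht t (-1 * (t - 0)) 0) with (- la / 2 / (1 + t) ^ 2 + Hr t (-1 * (t - 0)) 0) by lra.
    replace (x + 1 * (t - 0)) with (x + t) by ring.
    replace (x + -1 * (t - 0)) with (x - t) by ring.
    field; lra. }
  assert (WB' : forall t x, 0 <= t ->
     Btt t x 0 - Bxx t x 0 + la / (1 + t) ^ 2 * cone (fun _ => v1) Q t x 0 = 0).
  { intros t x Htp; rewrite (WB t x 0) by (try lra; intros; apply PQ; lra).
    unfold edge.
    assert (e1 := BQ t 0 1 ltac:(ring)). assert (e2 := BQ t 0 (-1) ltac:(ring)).
    replace (Qt t (1 * (t - 0)) 0) with (- Qr t (1 * (t - 0)) 0) by lra.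
    replace (Qt t (-1 * (t - 0)) 0) with (Qr t (-1 * (t - 0)) 0) by lra.
    ring. }
  assert (HP0 : P 0 = 1) by apply HP.
  (* At the apex s = 0, so the Duhamel source is 2 [g]; the overall factor 1/2 reduces it to [g]. *)
  assert (Q0 : forall t, 0 <= t -> Q t 0 t = 1).
  { intros t Htp; rewrite EQ by lra; rewrite <- HP0; f_equal; field; lra. }
  exists (fun t x => / 2 * (q t * (u0 (x + t) + u0 (x - t) + cone (fun _ => u0) H t x 0
        + cone (fun _ => v1) Q t x 0 + duhamel (cone g Q) t x 0))), Q, H, w.
  split; [| repeat (split; [assumption |]); split; [intros b Hb; apply Ew, Hb |]].
  2:{ intros t x Htp; destruct (Eq t Htp) as (-> & _); unfold v1, g; ring. }
  destruct CU as (CU0 & CU1 & CU2).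
  assert (F0 := is_C1_half_of_C1p _ _ _ 0 CU0).
  assert (F1 := is_C1_half_of_C1p _ _ _ 0 CU1).
  assert (F2 := is_C1_half_of_C1p _ _ _ 0 CU2).
  do 6 eexists; split; [split; [exact F0 | split; [exact F1 | exact F2]] |].
  cbv beta.
  assert (d0 : forall S x, duhamel S 0 x 0 = 0).
  { intros S x; unfold duhamel; apply (RInt_point (V := R_CompleteNormedModule)). }
  split; [|split].
  - intros t x Htp.
    assert (Htp' : 0 <= t) by lra.
    destruct (Eq t Htp') as (-> & -> & ->).
    rewrite (Q0 t Htp').
    assert (e0 := WD t x Htp'). assert (e1 := WA' t x Htp'). assert (e2 := WB' t x Htp').
    assert (Eg : Rpower (1 + t) (- (mu / 2)) * g t x = f t x).
    { unfold g; rewrite Rmax_left by lra; rewrite (proj1 (Ew t Htp')).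
      rewrite <- Rmult_assoc, <- Rpower_plus.
      replace (- (mu / 2) + mu / 2) with 0 by ring; rewrite Rpower_O by lra; ring. }
    revert Eg; generalize (Rpower (1 + t) (- (mu / 2))); intros r Eg; rewrite <- Eg.
    replace (Att t x 0) with (Axx t x 0 - la / (1 + t) ^ 2 * cone (fun _ => u0) H t x 0
      - la / (1 + t) ^ 2 * (u0 (x + t) + u0 (x - t))) by lra.
    replace (Btt t x 0) with (Bxx t x 0 - la / (1 + t) ^ 2 * cone (fun _ => v1) Q t x 0) by lra.
    replace (duhamel Stt t x 0) with
      (duhamel Sxx t x 0 - la / (1 + t) ^ 2 * duhamel (cone g Q) t x 0) by lra.
    unfold la; field; lra.
  - intros x; destruct (Eq 0 (Rle_refl 0)) as (-> & _).
    rewrite !cone_diag, d0, !Rplus_0_r, Rminus_0_r.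
    unfold Rpower; rewrite ln_1, Rmult_0_r, exp_0; field.
  (* Three contributions remain: -mu/2 [u0] from the derivative of (1+t)^(-mu/2), zero from [H]
     since ds/db = 0 at t = r = 0, and [v1] from [Q]. *)
  - intros x; destruct (Eq 0 (Rle_refl 0)) as (-> & -> & _).
    rewrite !cone_diag, !d0, At0, Bt0, Q0, EH, !Rplus_0_r, Rminus_0_r by lra.
    unfold Rpower; rewrite ln_1, Rmult_0_r, exp_0; unfold v1; field.
Qed.

(** * Uniqueness *)

(** Compactness on the slice b = 0 gives a first bound; uniform continuity then lets it grow by at
    most 1 for each strip of height [del]/2, and finitely many strips reach T. *)
Lemma continuous_bounded_rectangle (F : R -> R -> R) (T c d : R) :
  cont2 F -> 0 <= T ->
  exists M, forall b y, 0 <= b <= T -> c <= y <= d -> Rabs (F b y) <= M.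
Proof.
  intros HF HT.
  destruct (uniform_continuity_2d F 0 T c d) with (eps := mkposreal 1 Rlt_0_1)
    as [del Hdel].
  { intros x y _ _; apply continuous_continuity_2d; cont. }
  destruct (bounded_continuity (K := R_AbsRing) (V := R_NormedModule) (F 0) c d) as [M HM].
  { intros y _; change (continuous (F 0) y); cont. }
  assert (Hn : forall n b y, 0 <= b <= T -> c <= y <= d -> b <= INR n * (del / 2) ->
    Rabs (F b y) <= M + INR n).
  { assert (Hd := cond_pos del).
    induction n as [|n IH]; intros b y Hb Hy Hbn.
    - simpl in *; replace b with 0 by lra; assert (h := HM y Hy).
      change (Rabs (F 0 y) < M) in h; lra.
    - rewrite S_INR in *.
      assert (Hb' : 0 <= Rmax 0 (b - del / 2) <= T).
      { split; [apply Rmax_l | apply Rmax_lub; lra]. }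
      assert (h : Rabs (F (Rmax 0 (b - del / 2)) y) <= M + INR n).
      { apply IH; try assumption; apply Rmax_lub; [|lra].
        apply Rmult_le_pos; [apply pos_INR | lra]. }
      assert (h' : Rabs (F b y - F (Rmax 0 (b - del / 2)) y) < 1).
      { apply (Hdel (Rmax 0 (b - del / 2)) y b y); try assumption.
        - apply Rabs_lt_between'; unfold Rmax; destruct (Rle_dec 0 (b - del / 2)); lra.
        - rewrite Rminus_diag, Rabs_R0; lra. }
      assert (h2 := Rabs_triang (F b y - F (Rmax 0 (b - del / 2)) y)
        (F (Rmax 0 (b - del / 2)) y)).
      replace (F b y - F (Rmax 0 (b - del / 2)) y + F (Rmax 0 (b - del / 2)) y)
        with (F b y) in h2 by ring.
      lra. }
  assert (Hd := cond_pos del).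
  destruct (nfloor_ex (T / (del / 2))) as [n [_ Hn2]].
  { apply Rdiv_le_0_compat; lra. }
  exists (M + INR (S n)); intros b y Hb Hy; apply Hn; try assumption.
  apply Rle_trans with T; [lra |].
  apply Rlt_le, Rlt_div_l; [lra |]; rewrite S_INR; lra.
Qed.

(** By the mean value theorem C/k exp(ks) - phi and C/k exp(ks) + phi do not fall below their
    initial value C/k. The gain is the factor 1/k, which a large weight exponent makes as small as
    desired. *)
Lemma exp_growth_bound (phi dphi : R -> R) (C k t : R) :
  0 <= t -> 0 <= C -> 0 < k ->
  (forall s, 0 < s < t -> is_derive phi s (dphi s)) ->
  (forall s, 0 <= s <= t -> continuous phi s) ->
  (forall s, 0 <= s <= t -> Rabs (dphi s) <= C * exp (k * s)) ->
  phi 0 = 0 -> Rabs (phi t) <= C / k * exp (k * t).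
Proof.
  intros Ht HC Hk HD Hc Hb H0.
  assert (Hck : 0 <= C / k) by (apply Rdiv_le_0_compat; lra).
  assert (X : forall sg, sg * sg = 1 -> 0 <= C / k * exp (k * t) - sg * phi t).
  { intros sg Hsg.
    assert (De : forall s, is_derive (fun s => C / k * exp (k * s)) s (C * exp (k * s))).
    { intros s; auto_derive; [exact I | field; lra]. }
    destruct (MVT_gen (fun s => C / k * exp (k * s) - sg * phi s) 0 t
      (fun s => C * exp (k * s) - sg * dphi s)) as [s [Hs E]].
    1,2,3: rewrite ?Rmin_left, ?Rmax_right in * by lra.
    - intros s Hs; apply (is_derive_minus (V := R_NormedModule)); [apply De |].
      apply is_derive_scal, HD, Hs.
    - intros s Hs; apply continuity_pt_filterlim.
      apply (continuous_Rminus (U := R_UniformSpace)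
        (fun s => C / k * exp (k * s)) (fun s => sg * phi s)).
      + apply (ex_derive_continuous (V := R_NormedModule)); eexists; apply De.
      + apply (continuous_Rmult (U := R_UniformSpace) (fun _ => sg) phi);
          [apply continuous_const | apply Hc, Hs].
    - cbv beta in E; rewrite H0, !Rmult_0_r, exp_0, Rmult_1_r in E.
      assert (hb := Hb s Hs).
      assert (h : sg * dphi s <= Rabs (dphi s)).
      { apply Rle_trans with (1 := Rle_abs _); rewrite Rabs_mult.
        assert (Rabs sg = 1) by (unfold Rabs; destruct (Rcase_abs sg); nra).
        nra. }
      assert (0 <= (C * exp (k * s) - sg * dphi s) * (t - 0)) by (apply Rmult_le_pos; lra).
      lra. }
  apply Rabs_le.
  assert (h1 := X 1 ltac:(ring)). assert (h2 := X (-1) ltac:(ring)). lra.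
Qed.

Lemma is_derive_of_is_derive_t (g : R -> R -> R) (t x l : R) :
  0 < t -> is_derive_t g t x l -> is_derive (fun s => g s x) t l.
Proof.
  intros Ht [L D]; split; [exact L |].
  intros y Hy eps.
  apply (is_filter_lim_locally_unique (K := R_AbsRing) (V := R_NormedModule)) in Hy; subst y.
  assert (h := D t (filter_le_within (F := locally t) _) eps).
  unfold within in h.
  assert (h0 : locally t (fun s => 0 <= s)).
  { apply (filter_imp (fun s => 0 < s)); [intros; lra |].
    apply (open_gt 0 t Ht). }
  generalize (filter_and _ _ h h0); apply filter_imp; intros s [A B]; apply A, B.
Qed.

Lemma locally_pos_time (t x : R) :
  0 < t -> locally (t, x) (fun p : R * R => 0 < fst p).
Proof.
  intros Ht; apply (continuous_fst (U := R_UniformSpace) (V := R_UniformSpace) t x).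
  apply (open_gt 0 t Ht).
Qed.

Lemma continuous_half_interior (g : R -> R -> R) (t x : R) :
  continuous_half g -> 0 < t -> continuous (fun p : R * R => g (fst p) (snd p)) (t, x).
Proof.
  intros Hg Ht P HP.
  assert (h := Hg t x (Rlt_le _ _ Ht) P HP).
  unfold filtermap, within in h; unfold filtermap.
  generalize (filter_and _ _ (locally_pos_time t x Ht) h).
  apply filter_imp; intros p [A B]; apply B; lra.
Qed.

(** In [is_C2_half] the two mixed derivatives are independent witnesses. Their equality, by Schwarz'
    theorem in the open half plane, is what factors the wave operator into two transport
    operators. *)
Lemma mixed_partials_commute g gt gx gtt gtx gxt gxx t x :
  is_C2_half g gt gx gtt gtx gxt gxx -> 0 < t -> gtx t x = gxt t x.
Proof.
  intros ((_ & _ & _ & D) & (_ & _ & Ctx & Dt) & (_ & Cxt & _ & Dx)) Ht.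
  assert (Pt : forall s y, 0 < s -> is_derive (fun z => g z y) s (gt s y)).
  { intros s y Hs; apply is_derive_of_is_derive_t; [exact Hs |]; apply D; lra. }
  assert (Px : forall s y, 0 < s -> is_derive (fun z => g s z) y (gx s y)).
  { intros s y Hs; apply D; lra. }
  assert (Pxt : forall s y, 0 < s ->
    is_derive (fun z => Derive (fun w => g z w) y) s (gxt s y)).
  { intros s y Hs; apply is_derive_ext_loc with (fun z => gx z y).
    - apply (filter_imp (fun z => 0 < z)); [|apply (open_gt 0 s Hs)].
      intros z Hz; symmetry; apply is_derive_unique, Px, Hz.
    - apply is_derive_of_is_derive_t; [exact Hs |]; apply Dx; lra. }
  assert (Ptx : forall s y, 0 < s ->
    is_derive (fun z => Derive (fun w => g w z) s) y (gtx s y)).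
  { intros s y Hs; apply is_derive_ext with (fun z => gt s z).
    - intros z; symmetry; apply is_derive_unique, Pt, Hs.
    - apply Dt; lra. }
  rewrite <- (is_derive_unique _ _ _ (Pxt t x Ht)), <- (is_derive_unique _ _ _ (Ptx t x Ht)).
  symmetry; apply Schwarz.
  - apply locally_2d_locally; generalize (locally_pos_time t x Ht); apply filter_imp.
    intros [s y] Hs; simpl in *; repeat split; eexists.
    + apply Pt, Hs. + apply Px, Hs. + apply Pxt, Hs. + apply Ptx, Hs.
  - apply continuity_2d_pt_ext_loc with gxt.
    + apply locally_2d_locally; generalize (locally_pos_time t x Ht); apply filter_imp.
      intros [s y] Hs; symmetry; apply is_derive_unique, Pxt, Hs.
    + apply continuous_continuity_2d, continuous_half_interior; assumption.
  - apply continuity_2d_pt_ext_loc with gtx.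
    + apply locally_2d_locally; generalize (locally_pos_time t x Ht); apply filter_imp.
      intros [s y] Hs; symmetry; apply is_derive_unique, Ptx, Hs.
    + apply continuous_continuity_2d, continuous_half_interior; assumption.
Qed.

Lemma is_derive_along_characteristic g gt gx c s x :
  is_C1_half g gt gx -> 0 < s ->
  is_derive (fun z => g z (x + c * z)) s (gt s (x + c * s) + c * gx s (x + c * s)).
Proof.
  intros (_ & Ct & _ & D) Hs.
  replace (gt s (x + c * s)) with (1 * gt s (x + c * s)) by ring.
  apply (is_derive_comp_2 g gt gx (fun z => z) (fun z => x + c * z)).
  - generalize (locally_pos_time s (x + c * s) Hs); apply filter_imp.
    intros [z y] Hz; simpl in *; apply is_derive_of_is_derive_t; [exact Hz |]; apply D; lra.
  - apply D; lra.
  - apply continuous_half_interior; assumption.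
  - apply (is_derive_id (K := R_AbsRing)).
  - auto_derive; [exact I | real_ring].
Qed.

Lemma continuous_half_minus g h :
  continuous_half g -> continuous_half h -> continuous_half (fun t x => g t x - h t x).
Proof.
  intros Hg Hh t x Ht.
  apply (filterlim_comp_2 (G := locally (g t x)) (H := locally (h t x)) _ _
    (fun a b : R => a + - b) (Hg t x Ht) (Hh t x Ht)).
  apply (filterlim_comp_2 (G := locally (g t x)) (H := locally (- h t x)) _ _
    Rplus).
  - apply filterlim_fst.
  - apply (filterlim_comp _ _ _ snd Ropp _ (locally (h t x)));
      [apply filterlim_snd | apply (filterlim_opp (V := R_NormedModule))].
  - apply (filterlim_plus (V := R_NormedModule)).
Qed.

Lemma is_C1_half_minus g gt gx h ht hx :
  is_C1_half g gt gx -> is_C1_half h ht hx ->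
  is_C1_half (fun t x => g t x - h t x) (fun t x => gt t x - ht t x)
    (fun t x => gx t x - hx t x).
Proof.
  intros (G1 & G2 & G3 & G4) (H1 & H2 & H3 & H4).
  split; [|split; [|split]]; try (apply continuous_half_minus; assumption).
  intros t x Ht; destruct (G4 t x Ht) as [A B]; destruct (H4 t x Ht) as [C D]; split.
  - assert (K := within_half_line_proper t Ht).
    assert (E := filterdiff_minus_fct _ _ _ _ A C).
    eapply filterdiff_ext_lin; [apply E |].
    intros y; unfold minus, plus, opp, scal; simpl; unfold mult; simpl; ring.
  - apply (is_derive_minus (V := R_NormedModule)); assumption.
Qed.

Lemma classical_solution_minus mu nu2 f u0 u1 u v :
  classical_solution mu nu2 f u0 u1 u -> classical_solution mu nu2 f u0 u1 v ->
  classical_solution mu nu2 (fun _ _ => 0) (fun _ => 0) (fun _ => 0)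
    (fun t x => v t x - u t x).
Proof.
  intros (ut & ux & utt & utx & uxt & uxx & (A & B & C) & D & E & F)
         (vt & vx & vtt & vtx & vxt & vxx & (A' & B' & C') & D' & E' & F').
  do 6 eexists; split; [split; [|split]; apply is_C1_half_minus; eassumption |].
  split; [|split].
  - intros t x Ht; assert (h := D t x Ht); assert (h' := D' t x Ht); cbv beta; lra.
  - intros x; rewrite E, E'; ring.
  - intros x; cbv beta; rewrite F, F'; ring.
Qed.

(** The least such M is a weighted supremum norm on the backward cone with apex (T,x0). The
    combinations w_t - w_x and w_t + w_x are used because each is transported along one family of
    characteristics. *)
Definition cone_bound (w wt wx : R -> R -> R) (k T x0 M : R) : Prop :=
  forall t x, 0 <= t -> Rabs (x - x0) <= T - t ->
    Rabs (w t x) <= M * exp (k * t) /\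
    Rabs (wt t x - wx t x) <= M * exp (k * t) /\
    Rabs (wt t x + wx t x) <= M * exp (k * t).

Lemma cone_bound_exists w wt wx k T x0 :
  continuous_half w -> continuous_half wt -> continuous_half wx -> 0 <= k -> 0 <= T ->
  exists M, 0 <= M /\ cone_bound w wt wx k T x0 M.
Proof.
  intros H Ht Hx Hk HT.
  assert (X : forall g, continuous_half g -> exists M, 0 <= M /\ forall t x, 0 <= t ->
    Rabs (x - x0) <= T - t -> Rabs (g t x) <= M * exp (k * t)).
  { intros g Hg.
    destruct (continuous_bounded_rectangle _ T (x0 - T) (x0 + T)
      (cont2_half_extension g Hg) HT) as [M HM].
    assert (HM0 : 0 <= M).
    { apply Rle_trans with (1 := Rabs_pos (g (Rmax 0 0) x0)); apply HM; lra. }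
    exists M; split; [exact HM0 |].
    intros t x Htp Hxp.
    assert (h := Rabs_pos (x - x0)); apply Rabs_le_between in Hxp.
    assert (hm := HM t x ltac:(lra) ltac:(lra)); cbv beta in hm.
    rewrite Rmax_left in hm by lra.
    assert (he := exp_ineq1_le (k * t)).
    assert (0 <= k * t) by (apply Rmult_le_pos; lra).
    nra. }
  destruct (X w H) as (M1 & P1 & B1).
  destruct (X _ (continuous_half_minus _ _ Ht Hx)) as (M2 & P2 & B2).
  destruct (X wt Ht) as (M3 & P3 & B3). destruct (X wx Hx) as (M4 & P4 & B4).
  exists (M1 + M2 + M3 + M4); split; [lra |].
  intros t x Htp Hxp.
  assert (he := exp_pos (k * t)).
  assert (b1 := B1 t x Htp Hxp). assert (b2 := B2 t x Htp Hxp).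
  assert (b3 := B3 t x Htp Hxp). assert (b4 := B4 t x Htp Hxp).
  assert (h := Rabs_triang (wt t x) (wx t x)).
  assert (0 <= M1 * exp (k * t)) by nra. assert (0 <= M2 * exp (k * t)) by nra.
  assert (0 <= M3 * exp (k * t)) by nra. assert (0 <= M4 * exp (k * t)) by nra.
  repeat split; lra.
Qed.

(** For c^2 = 1 the derivative of w_t - c w_x in the direction (1,c) is w_tt - w_xx, hence of lower
    order by the equation, with coefficients bounded by |mu| and |nu2| because 1/(1+t) <= 1. The
    extra 1 in the bound on k pays for the equation w' = w_t. *)
Lemma cone_bound_halves mu nu2 w wt wx wtt wtx wxt wxx k T x0 M :
  is_C2_half w wt wx wtt wtx wxt wxx ->
  (forall t x, 0 < t ->
     wtt t x - wxx t x + mu / (1 + t) * wt t x + nu2 / (1 + t) ^ 2 * w t x = 0) ->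
  (forall x, w 0 x = 0) -> (forall x, wt 0 x = 0) ->
  2 * (Rabs mu + Rabs nu2 + 1) <= k -> 0 <= M ->
  cone_bound w wt wx k T x0 M -> cone_bound w wt wx k T x0 (M / 2).
Proof.
  intros HC2 HE H0 H1 Hk HM HB.
  assert (Hsw := mixed_partials_commute w wt wx wtt wtx wxt wxx).
  destruct HC2 as (CW & CT & CX).
  assert (Hmu := Rabs_pos mu). assert (Hnu := Rabs_pos nu2).
  assert (Hx0 : forall x, wx 0 x = 0).
  { intros x.
    assert (D : is_derive (fun z => w 0 z) x (wx 0 x)) by apply CW, Rle_refl.
    apply is_derive_unique in D; rewrite <- D.
    rewrite (Derive_ext _ (fun _ => 0)) by apply H0; apply Derive_const. }
  (* Freezing the time argument at 0 gives two-sided continuity at s = 0, as the growth estimate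
     demands. *)
  assert (Ext : forall g, continuous_half g -> forall a c s : R, 0 <= s ->
    continuous (fun z => g (Rmax z 0) (a + c * z)) s).
  { intros g Hg a c s Hs; assert (K := cont2_half_extension g Hg).
    apply (K _ (fun z => z) (fun z => a + c * z)); cont. }
  assert (Loc : forall (g : R -> R -> R) (a c s l : R), 0 < s ->
    is_derive (fun z => g z (a + c * z)) s l ->
    is_derive (fun z => g (Rmax z 0) (a + c * z)) s l).
  { intros g a c s l Hs; apply is_derive_ext_loc.
    apply (filter_imp (fun z => 0 < z)); [|apply (open_gt 0 s Hs)].
    intros z Hz; rewrite Rmax_left; [reflexivity | lra]. }
  assert (Halve : forall C t, 0 <= C -> C <= (Rabs mu + Rabs nu2 + 1) * M ->
    C / k * exp (k * t) <= M / 2 * exp (k * t)).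
  { intros C t HC HCM; apply Rmult_le_compat_r; [apply Rlt_le, exp_pos |].
    apply Rle_div_l; [lra |]. nra. }
  assert (Wt : forall t x, 0 <= t -> Rabs (x - x0) <= T - t ->
    Rabs (wt t x) <= M * exp (k * t)).
  { intros t x Htp Hxp; destruct (HB t x Htp Hxp) as (_ & b1 & b2).
    apply Rabs_le_between in b1, b2; apply Rabs_le; lra. }
  assert (Main : forall c, c * c = 1 -> forall t x, 0 <= t -> Rabs (x - x0) <= T - t ->
    Rabs (wt t x - c * wx t x) <= M / 2 * exp (k * t)).
  { intros c Hc t x Htp Hxp.
    assert (Hc1 : Rabs c = 1) by (unfold Rabs; destruct (Rcase_abs c); nra).
    set (a := x - c * t).
    (* Followed backwards from a point of the cone, the characteristic stays in the cone. *)
    assert (Dom : forall s, 0 <= s <= t -> Rabs (a + c * s - x0) <= T - s).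
    { intros s Hs; unfold a.
      replace (x - c * t + c * s - x0) with ((x - x0) + - (c * (t - s))) by ring.
      apply Rle_trans with (1 := Rabs_triang _ _).
      rewrite Rabs_Ropp, Rabs_mult, Hc1, (Rabs_pos_eq (t - s)) by lra; lra. }
    assert (G := exp_growth_bound
      (fun s => wt (Rmax s 0) (a + c * s) - c * wx (Rmax s 0) (a + c * s))
      (fun s => - (mu / (1 + s)) * wt s (a + c * s) - nu2 / (1 + s) ^ 2 * w s (a + c * s))
      ((Rabs mu + Rabs nu2) * M) k t Htp ltac:(nra) ltac:(lra)).
    cbv beta in G; rewrite (Rmax_left t 0 Htp) in G.
    replace (a + c * t) with x in G by (unfold a; ring).
    apply Rle_trans with (2 := Halve ((Rabs mu + Rabs nu2) * M) t ltac:(nra) ltac:(nra)).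
    apply G; clear G.
    - intros s Hs.
      replace (- (mu / (1 + s)) * wt s (a + c * s) - nu2 / (1 + s) ^ 2 * w s (a + c * s))
        with ((wtt s (a + c * s) + c * wtx s (a + c * s))
              - c * (wxt s (a + c * s) + c * wxx s (a + c * s))).
      + apply (is_derive_minus (V := R_NormedModule)).
        * apply Loc; [lra | apply is_derive_along_characteristic; [exact CT | lra]].
        * apply is_derive_scal, Loc; [lra | apply is_derive_along_characteristic; [exact CX | lra]].
      + assert (e := HE s (a + c * s) ltac:(lra)).
        assert (e2 := Hsw s (a + c * s) (conj CW (conj CT CX)) ltac:(lra)).
        rewrite e2.
        transitivity (wtt s (a + c * s) - (c * c) * wxx s (a + c * s)); [ring |].
        rewrite Hc; lra.
    - intros s Hs; apply (continuous_Rminus (U := R_UniformSpace)).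
      + apply Ext; [apply CW | lra].
      + apply (continuous_Rmult (U := R_UniformSpace) (fun _ => c));
          [apply continuous_const | apply Ext; [apply CW | lra]].
    - intros s Hs.
      assert (b1 := Wt s (a + c * s) ltac:(lra) (Dom s Hs)).
      destruct (HB s (a + c * s) ltac:(lra) (Dom s Hs)) as (b0 & _).
      assert (i1 : 0 < / (1 + s) <= 1).
      { split; [apply Rinv_0_lt_compat; lra |]. rewrite <- Rinv_1 at 2.
        apply Rinv_le_contravar; lra. }
      assert (i2 : 0 < / (1 + s) ^ 2 <= 1).
      { rewrite <- pow_inv; split; [apply pow_lt; lra |]; simpl; nra. }
      unfold Rminus; apply Rle_trans with (1 := Rabs_triang _ _).
      unfold Rdiv; rewrite Rabs_Ropp, !Rabs_mult, Rabs_Ropp, !Rabs_mult.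
      rewrite (Rabs_pos_eq (/ (1 + s))), (Rabs_pos_eq (/ (1 + s) ^ 2)) by lra.
      assert (Rabs mu * / (1 + s) * Rabs (wt s (a + c * s)) <= Rabs mu * (M * exp (k * s))).
      { apply Rmult_le_compat; try nra; try apply Rabs_pos. }
      assert (Rabs nu2 * / (1 + s) ^ 2 * Rabs (w s (a + c * s)) <= Rabs nu2 * (M * exp (k * s))).
      { apply Rmult_le_compat; try nra; try apply Rabs_pos. }
      lra.
    - rewrite Rmax_left by lra; rewrite H1, Hx0; ring. }
  intros t x Htp Hxp; split; [|split].
  (* The function itself is integrated along a vertical line, that is, with slope c = 0. *)
  - assert (G := exp_growth_bound (fun s => w (Rmax s 0) (x + 0 * s))
      (fun s => wt s (x + 0 * s)) M k t Htp HM ltac:(lra)).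
    cbv beta in G; rewrite (Rmax_left t 0 Htp) in G.
    replace (x + 0 * t) with x in G by ring.
    apply Rle_trans with (2 := Halve M t HM ltac:(nra)).
    apply G; clear G.
    + intros s Hs; apply Loc; [lra |].
      replace (wt s (x + 0 * s)) with (wt s (x + 0 * s) + 0 * wx s (x + 0 * s)) by ring.
      apply is_derive_along_characteristic; [exact CW | lra].
    + intros s Hs; apply Ext; [apply CW | lra].
    + intros s Hs; rewrite Rmult_0_l, Rplus_0_r; apply Wt; lra.
    + rewrite Rmax_left by lra; apply H0.
  - assert (h := Main 1 ltac:(ring) t x Htp Hxp); rewrite Rmult_1_l in h; exact h.
  - assert (h := Main (-1) ltac:(ring) t x Htp Hxp).
    replace (wt t x + wx t x) with (wt t x - -1 * wx t x) by ring; exact h.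
Qed.

Lemma classical_solution_unique mu nu2 f u0 u1 u v :
  classical_solution mu nu2 f u0 u1 u -> classical_solution mu nu2 f u0 u1 v ->
  forall t x, 0 <= t -> v t x = u t x.
Proof.
  intros Hu Hv t x Ht.
  destruct (classical_solution_minus _ _ _ _ _ _ _ Hu Hv)
    as (wt & wx & wtt & wtx & wxt & wxx & HC & HE & H0 & H1).
  set (w := fun t x => v t x - u t x) in *.
  set (k := 2 * (Rabs mu + Rabs nu2 + 1)).
  assert (Hk : 0 <= k) by (unfold k; assert (h := Rabs_pos mu); assert (h' := Rabs_pos nu2); lra).
  (* The apex of the cone is the point (t,x) at which the two solutions are compared. *)
  destruct (cone_bound_exists w wt wx k t x) as (M & HM & HB); try apply HC; try lra.
  assert (Hn : forall n, cone_bound w wt wx k t x (M * (/ 2) ^ n)).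
  { induction n as [|n IH]; [rewrite pow_O, Rmult_1_r; exact HB |].
    replace (M * (/ 2) ^ S n) with (M * (/ 2) ^ n / 2) by (simpl; field).
    apply (cone_bound_halves mu nu2 w wt wx wtt wtx wxt wxx); try assumption.
    - apply Rle_refl.
    - apply Rmult_le_pos; [exact HM | apply pow_le; lra]. }
  assert (Hw : Rabs (w t x) <= 0).
  { apply (is_lim_seq_le (fun _ => Rabs (w t x)) (fun n => M * exp (k * t) * (/ 2) ^ n)
      (Rabs (w t x)) 0).
    - intros n; destruct (Hn n t x Ht) as (h & _).
      + rewrite !Rminus_diag, Rabs_R0; lra.
      + lra.
    - apply is_lim_seq_const.
    - replace (Finite 0) with (Rbar_mult (M * exp (k * t)) 0) by (simpl; f_equal; ring).
      apply is_lim_seq_scal_l, is_lim_seq_geom; rewrite Rabs_pos_eq; lra. }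
  assert (h := Rabs_pos (w t x)).
  assert (E : w t x = 0) by (apply Rabs_eq_0; lra).
  unfold w in E; lra.
Qed.

(** * Power series on the unit disk *)

Definition unit_disk_convergent (a : nat -> R) : Prop :=
  forall x, Rabs x < 1 -> Rbar_lt (Rabs x) (CV_radius a).

(** The radius of convergence is the supremum of all r with d_n r^n bounded, so such an r exists
    beyond |x|; domination passes the bound on to [a]. *)
Lemma unit_disk_convergent_dominated (a d : nat -> R) :
  CV_radius d = 1 -> (forall n, Rabs (a n) <= d n) -> unit_disk_convergent a.
Proof.
  intros Hd Had x Hx.
  assert (Lub := CV_radius_bounded d); rewrite Hd in Lub.
  destruct (classic (exists r, Rabs x < r /\ exists M, forall n, Rabs (d n * r ^ n) <= M))
    as [(r & Hr & M & HM) | Hn].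
  - apply Rbar_lt_le_trans with r; [exact Hr |].
    apply (CV_radius_bounded a); exists M; intros n.
    apply Rle_trans with (2 := HM n); rewrite !Rabs_mult.
    apply Rmult_le_compat_r; [apply Rabs_pos |].
    apply Rle_trans with (1 := Had n), Rle_abs.
  - assert (U : is_ub_Rbar (fun r => exists M, forall n, Rabs (d n * r ^ n) <= M) (Rabs x)).
    { intros r Hr; simpl; apply Rnot_lt_le; intros Hlt; apply Hn; exists r; auto. }
    assert (h := proj2 Lub _ U); simpl in h; lra.
Qed.

(** The hypergeometric coefficients have ratio ((n+al)/(n+1))^2 and vanish from some index on when
    al is a nonpositive integer, where the ratio test does not apply. With m = |al| + 1 this
    sequence dominates them and stays positive. *)
Fixpoint ratio_majorant (m : R) (n : nat) : R :=
  match n with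
  | O => 1
  | S p => ratio_majorant m p * ((INR p + m) / (INR p + 1)) ^ 2
  end.

Lemma ratio_majorant_pos m n : 0 < m -> 0 < ratio_majorant m n.
Proof.
  intros Hm; induction n as [|n IH]; simpl; [lra |].
  assert (h := pos_INR n).
  assert (0 < (INR n + m) / (INR n + 1)) by (apply Rdiv_lt_0_compat; lra).
  apply Rmult_lt_0_compat; [exact IH | nra].
Qed.

Lemma CV_radius_ratio_majorant m : 0 < m -> CV_radius (ratio_majorant m) = 1.
Proof.
  intros Hm.
  replace (Finite 1) with (Finite (/ 1)) by (f_equal; field).
  apply CV_radius_finite_DAlembert; [|lra|].
  - intros n; assert (h := ratio_majorant_pos m n Hm); lra.
  - apply is_lim_seq_ext with
      (fun n => (1 + (m - 1) * / (INR n + 1)) * (1 + (m - 1) * / (INR n + 1))).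
    + intros n; simpl.
      assert (h := ratio_majorant_pos m n Hm); assert (h' := pos_INR n).
      assert (0 < (INR n + m) / (INR n + 1)) by (apply Rdiv_lt_0_compat; lra).
      replace (ratio_majorant m n * ((INR n + m) / (INR n + 1)
        * ((INR n + m) / (INR n + 1) * 1)) / ratio_majorant m n)
        with ((INR n + m) / (INR n + 1) * ((INR n + m) / (INR n + 1))) by (field; lra).
      rewrite Rabs_pos_eq by nra; field; lra.
    + replace (Finite 1) with (Finite ((1 + (m - 1) * 0) * (1 + (m - 1) * 0)))
        by (f_equal; ring).
      assert (L : is_lim_seq (fun n => 1 + (m - 1) * / (INR n + 1)) (1 + (m - 1) * 0)).
      { apply is_lim_seq_plus'; [apply is_lim_seq_const |].
        apply (is_lim_seq_scal_l _ (m - 1) 0).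
        apply is_lim_seq_ext with (fun n => / INR (S n)).
        - intros n; rewrite S_INR; reflexivity.
        - apply (is_lim_seq_incr_1 (fun n => / INR n)).
          apply (is_lim_seq_inv _ p_infty); [apply is_lim_seq_INR | discriminate]. }
      apply is_lim_seq_mult'; exact L.
Qed.

(** * The hypergeometric function F(al, al; 1; z) *)

Lemma Cpochhammer_1 n : Cpochhammer (RtoC 1) n = RtoC (INR (fact n)).
Proof.
  induction n as [|n IH]; [reflexivity |].
  cbn [Cpochhammer]; rewrite IH, <- RtoC_plus, <- RtoC_mult; f_equal.
  change (fact (S n)) with (S n * fact n)%nat.
  rewrite mult_INR, S_INR; ring.
Qed.

Lemma RtoC_neq_0 (x : R) : x <> 0 -> RtoC x <> RtoC 0.
Proof. intros H E; apply H, RtoC_inj, E. Qed.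

Lemma hyp2F1_coef_recurrence (al : C) (n : nat) :
  (RtoC ((INR n + 1) ^ 2) * hyp2F1_coef al al (RtoC 1) (S n)
   = (RtoC (INR n) + al) * (RtoC (INR n) + al) * hyp2F1_coef al al (RtoC 1) n)%C.
Proof.
  unfold hyp2F1_coef; rewrite !Cpochhammer_1; cbn [Cpochhammer].
  change (fact (S n)) with (S n * fact n)%nat.
  rewrite mult_INR, S_INR.
  assert (h1 : RtoC (INR (fact n)) <> RtoC 0) by (apply RtoC_neq_0, INR_fact_neq_0).
  assert (h2 : RtoC (INR n + 1) <> RtoC 0).
  { apply RtoC_neq_0; assert (h := pos_INR n); lra. }
  replace ((INR n + 1) ^ 2) with ((INR n + 1) * (INR n + 1)) by ring.
  rewrite !RtoC_mult.
  field; split; assumption.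
Qed.

Lemma hyp2F1_coef_majorant (al : C) (n : nat) :
  Cmod (hyp2F1_coef al al (RtoC 1) n) <= ratio_majorant (Cmod al + 1) n.
Proof.
  assert (Ha := Cmod_ge_0 al).
  induction n as [|n IH].
  - unfold hyp2F1_coef; simpl.
    replace (RtoC 1 * RtoC 1 / (RtoC 1 * RtoC 1))%C with (RtoC 1)
      by (field; apply RtoC_neq_0; lra).
    rewrite Cmod_1; lra.
  - assert (hn := pos_INR n).
    assert (E := f_equal Cmod (hyp2F1_coef_recurrence al n)).
    rewrite !Cmod_mult, Cmod_R, Rabs_pos_eq in E by (apply pow_le; lra).
    assert (B : Cmod (RtoC (INR n) + al) <= INR n + (Cmod al + 1)).
    { apply Rle_trans with (1 := Cmod_triangle _ _).
      rewrite Cmod_R, Rabs_pos_eq by exact hn; lra. }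
    assert (Hp := Cmod_ge_0 (RtoC (INR n) + al)).
    assert (Hc := Cmod_ge_0 (hyp2F1_coef al al (RtoC 1) n)).
    cbn [ratio_majorant].
    apply Rmult_le_reg_l with ((INR n + 1) ^ 2); [apply pow_lt; lra |].
    rewrite E.
    replace ((INR n + 1) ^ 2 * (ratio_majorant (Cmod al + 1) n *
       ((INR n + (Cmod al + 1)) / (INR n + 1)) ^ 2))
      with ((INR n + (Cmod al + 1)) * (INR n + (Cmod al + 1)) * ratio_majorant (Cmod al + 1) n)
      by (field; lra).
    apply Rmult_le_compat; [nra | exact Hc | nra | exact IH].
Qed.

Lemma im_le_Cmod (c : C) : Rabs (Im c) <= Cmod c.
Proof. apply Rle_trans with (2 := Rmax_Cmod c), Rmax_r. Qed.

Lemma hyp2F1_coef_convergent (al : C) :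
  unit_disk_convergent (fun n => Re (hyp2F1_coef al al (RtoC 1) n)) /\
  unit_disk_convergent (fun n => Im (hyp2F1_coef al al (RtoC 1) n)).
Proof.
  assert (h : CV_radius (ratio_majorant (Cmod al + 1)) = 1).
  { apply CV_radius_ratio_majorant; assert (h := Cmod_ge_0 al); lra. }
  split; apply (unit_disk_convergent_dominated _ _ h); intros n;
    apply Rle_trans with (2 := hyp2F1_coef_majorant al n);
    [apply re_le_Cmod | apply im_le_Cmod].
Qed.

Lemma unit_disk_convergent_derive a :
  unit_disk_convergent a -> unit_disk_convergent (PS_derive a).
Proof. intros H x Hx; rewrite CV_radius_derive; auto. Qed.

(** The Euler operator z d/dz on coefficients. It acts without index shift, which turns the
    hypergeometric equation into an identity between coefficients of equal index. *)
Definition PS_euler (a : nat -> R) (n : nat) : R := INR n * a n.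

Lemma PS_euler_incr a n : PS_incr_1 (PS_derive a) n = PS_euler a n.
Proof. unfold PS_euler, PS_derive; destruct n; [simpl; unfold zero; simpl; ring | reflexivity]. Qed.

Lemma unit_disk_convergent_euler a :
  unit_disk_convergent a -> unit_disk_convergent (PS_euler a).
Proof.
  intros H x Hx; rewrite <- (CV_radius_ext _ _ (PS_euler_incr a)), CV_radius_incr_1.
  apply unit_disk_convergent_derive; auto.
Qed.

Lemma PSeries_euler a x : PSeries (PS_euler a) x = x * PSeries (PS_derive a) x.
Proof. rewrite <- (PSeries_ext _ _ _ (PS_euler_incr a)); apply PSeries_incr_1. Qed.

Lemma PSeries_derive_euler a x :
  unit_disk_convergent a -> Rabs x < 1 ->
  PSeries (PS_derive (PS_euler a)) x =
    PSeries (PS_derive a) x + x * PSeries (PS_derive (PS_derive a)) x.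
Proof.
  intros H Hx.
  assert (D := is_derive_PSeries (PS_euler a) x (unit_disk_convergent_euler a H x Hx)).
  assert (D1 := is_derive_PSeries (PS_derive a) x (unit_disk_convergent_derive a H x Hx)).
  rewrite <- (is_derive_unique _ _ _ D).
  apply is_derive_unique.
  apply is_derive_ext with (fun z => z * PSeries (PS_derive a) z).
  - intros z; symmetry; apply PSeries_euler.
  - assert (M := is_derive_mult (K := R_AbsRing) _ _ x _ _ (is_derive_id (K := R_AbsRing) x) D1
      (fun n m => Rmult_comm n m)).
    replace (PSeries (PS_derive a) x + x * PSeries (PS_derive (PS_derive a)) x)
      with (plus (mult one (PSeries (PS_derive a) x)) (mult x (PSeries (PS_derive (PS_derive a)) x))).
    + exact M.
    + unfold plus, mult, one; simpl; ring.
Qed.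

Lemma PSeries_linear5 (a b c d e : nat -> R) (p q r s t x : R) :
  ex_pseries a x -> ex_pseries b x -> ex_pseries c x -> ex_pseries d x -> ex_pseries e x ->
  PSeries (fun n => p * a n + q * b n + r * c n + s * d n + t * e n) x =
    p * PSeries a x + q * PSeries b x + r * PSeries c x + s * PSeries d x + t * PSeries e x.
Proof.
  intros Ha Hb Hc Hd He.
  assert (S : forall (u : nat -> R) k, ex_pseries u x -> ex_pseries (PS_scal k u) x).
  { intros u k Hu; apply ex_pseries_scal; [apply Rmult_comm | exact Hu]. }
  rewrite <- !PSeries_scal, <- !PSeries_plus;
    repeat match goal with
    | |- ex_pseries (PS_plus _ _) _ => apply ex_pseries_plus
    | |- ex_pseries (PS_scal _ _) _ => apply S; assumption
    end.
  apply PSeries_ext; intros n; reflexivity.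
Qed.

(* With [c_n = A_n + i B_n] and [al = p + i q], the recurrence
   [(n+1)^2 c_(n+1) = (n+al)^2 c_n] is the equation
   [(z F')' = z (z F')' + 2 al z F' + al^2 F], split into real and imaginary parts. *)
Lemma PSeries_hypergeometric_equation (A B : nat -> R) (p q x : R) :
  unit_disk_convergent A -> unit_disk_convergent B -> Rabs x < 1 ->
  (forall n, (INR n + 1) ^ 2 * A (S n)
     = ((INR n + p) ^ 2 - q ^ 2) * A n - 2 * (INR n + p) * q * B n) ->
  PSeries (PS_derive A) x + x * PSeries (PS_derive (PS_derive A)) x
  = x * (PSeries (PS_derive A) x + x * PSeries (PS_derive (PS_derive A)) x)
    + 2 * p * (x * PSeries (PS_derive A) x) - 2 * q * (x * PSeries (PS_derive B) x)
    + (p ^ 2 - q ^ 2) * PSeries A x - 2 * p * q * PSeries B x.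
Proof.
  intros HA HB Hx Rec.
  assert (X : forall a, unit_disk_convergent a -> ex_pseries a x).
  { intros a Ha; apply CV_radius_inside, Ha, Hx. }
  assert (EA := unit_disk_convergent_euler A HA).
  assert (EB := unit_disk_convergent_euler B HB).
  assert (EEA := unit_disk_convergent_euler _ EA).
  rewrite <- !PSeries_derive_euler by assumption.
  rewrite <- !PSeries_euler.
  rewrite (PSeries_ext _ (fun n => 1 * PS_euler (PS_euler A) n + 2 * p * PS_euler A n
     + (- (2 * q)) * PS_euler B n + (p ^ 2 - q ^ 2) * A n + (- (2 * p * q)) * B n)).
  - rewrite PSeries_linear5 by (apply X; assumption). ring.
  - intros n; unfold PS_derive, PS_euler; rewrite S_INR.
    transitivity ((INR n + 1) ^ 2 * A (S n)); [ring |]; rewrite Rec; ring.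
Qed.

(** * Complex-valued functions of a real variable *)

Definition is_Cderive (f : R -> C) (z : R) (l : C) : Prop :=
  is_derive (fun x => Re (f x)) z (Re l) /\ is_derive (fun x => Im (f x)) z (Im l).

Lemma is_Cderive_eq f z l l' : is_Cderive f z l -> l = l' -> is_Cderive f z l'.
Proof. intros H <-; exact H. Qed.

Lemma is_Cderive_plus f g z l m :
  is_Cderive f z l -> is_Cderive g z m -> is_Cderive (fun x => f x + g x)%C z (l + m)%C.
Proof.
  intros [A B] [A' B']; split; apply (is_derive_plus (V := R_NormedModule)); assumption.
Qed.

Lemma is_Cderive_mult f g z l m :
  is_Cderive f z l -> is_Cderive g z m ->
  is_Cderive (fun x => f x * g x)%C z (l * g z + f z * m)%C.
Proof.
  intros [A B] [A' B'].
  assert (M := fun u v du dv Hu Hv =>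
    is_derive_mult (K := R_AbsRing) u v z du dv Hu Hv (fun n m => Rmult_comm n m)).
  split.
  - replace (Re (l * g z + f z * m)%C) with
      ((Re l * Re (g z) + Re (f z) * Re m) - (Im l * Im (g z) + Im (f z) * Im m))
      by (destruct l, m, (g z), (f z); simpl; ring).
    apply (is_derive_minus (V := R_NormedModule)); apply M; assumption.
  - replace (Im (l * g z + f z * m)%C) with
      ((Re l * Im (g z) + Re (f z) * Im m) + (Im l * Re (g z) + Im (f z) * Re m))
      by (destruct l, m, (g z), (f z); simpl; ring).
    apply (is_derive_plus (V := R_NormedModule)); apply M; assumption.
Qed.

Lemma is_Cderive_const (c : C) z : is_Cderive (fun _ => c) z (RtoC 0).
Proof. split; apply (is_derive_const (V := R_NormedModule)). Qed.

Lemma is_Cderive_RtoC (g : R -> R) (z l : R) : is_derive g z l -> is_Cderive (fun x => RtoC (g x)) z (RtoC l).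
Proof.
  intros H; split; [exact H |].
  change (is_derive (fun _ : R => 0) z 0); apply (is_derive_const (V := R_NormedModule)).
Qed.

Lemma Cexp_plus a b : (Cexp (a + b) = Cexp a * Cexp b)%C.
Proof.
  unfold Cexp; destruct a as [a1 a2], b as [b1 b2]; simpl.
  rewrite exp_plus, cos_plus, sin_plus; apply injective_projections; simpl; ring.
Qed.

Lemma Cexp_0 : Cexp (RtoC 0) = RtoC 1.
Proof. unfold Cexp; simpl; rewrite exp_0, cos_0, sin_0; apply injective_projections; simpl; ring. Qed.

Lemma Cexp_neq_0 a : Cexp a <> RtoC 0.
Proof.
  intros H; assert (E : (Cexp a * Cexp (- a) = RtoC 1)%C).
  { rewrite <- Cexp_plus, <- Cexp_0; f_equal; ring. }
  rewrite H in E; apply (f_equal fst) in E; simpl in E; lra.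
Qed.

Lemma Cexp_RtoC (x : R) : Cexp (RtoC x) = RtoC (exp x).
Proof. unfold Cexp; simpl; rewrite cos_0, sin_0; apply injective_projections; simpl; ring. Qed.

Lemma is_Cderive_Rcpow (al : C) (z : R) : z < 1 ->
  is_Cderive (fun x => Rcpow (1 - x) al) z (- al * RtoC (/ (1 - z)) * Rcpow (1 - z) al)%C.
Proof.
  intros Hz; destruct al as [p q]; unfold Rcpow, Cexp; split.
  - simpl; auto_derive; [lra |]; unfold Rminus; simpl; field; lra.
  - simpl; auto_derive; [lra |]; unfold Rminus; simpl; field; lra.
Qed.

Definition CPSeries (a : nat -> C) (x : R) : C :=
  (PSeries (fun n => Re (a n)) x, PSeries (fun n => Im (a n)) x).

Definition CPS_derive (a : nat -> C) (n : nat) : C := (RtoC (INR (S n)) * a (S n))%C.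

Definition unit_disk_Cconvergent (a : nat -> C) : Prop :=
  unit_disk_convergent (fun n => Re (a n)) /\ unit_disk_convergent (fun n => Im (a n)).

Lemma CPS_derive_Re a n : PS_derive (fun k => Re (a k)) n = Re (CPS_derive a n).
Proof. unfold PS_derive, CPS_derive, Re, Im, Cmult, RtoC; cbn [fst snd]; ring. Qed.

Lemma CPS_derive_Im a n : PS_derive (fun k => Im (a k)) n = Im (CPS_derive a n).
Proof. unfold PS_derive, CPS_derive, Re, Im, Cmult, RtoC; cbn [fst snd]; ring. Qed.

Lemma unit_disk_Cconvergent_derive a :
  unit_disk_Cconvergent a -> unit_disk_Cconvergent (CPS_derive a).
Proof.
  intros [H1 H2]; split; intros x Hx.
  - rewrite <- (CV_radius_ext _ _ (CPS_derive_Re a)); apply unit_disk_convergent_derive; assumption.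
  - rewrite <- (CV_radius_ext _ _ (CPS_derive_Im a)); apply unit_disk_convergent_derive; assumption.
Qed.

Lemma is_Cderive_CPSeries a x :
  unit_disk_Cconvergent a -> Rabs x < 1 ->
  is_Cderive (CPSeries a) x (CPSeries (CPS_derive a) x).
Proof.
  intros [H1 H2] Hx; split; simpl.
  - rewrite <- (PSeries_ext _ _ _ (CPS_derive_Re a)).
    apply is_derive_PSeries, H1, Hx.
  - rewrite <- (PSeries_ext _ _ _ (CPS_derive_Im a)).
    apply is_derive_PSeries, H2, Hx.
Qed.

Definition hyp_coef (al : C) : nat -> C := hyp2F1_coef al al (RtoC 1).

Lemma hyp_coef_Cconvergent al : unit_disk_Cconvergent (hyp_coef al).
Proof. exact (hyp2F1_coef_convergent al). Qed.

Lemma hypergeometric_equation (al : C) (x : R) :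
  Rabs x < 1 ->
  (CPSeries (CPS_derive (hyp_coef al)) x
     + RtoC x * CPSeries (CPS_derive (CPS_derive (hyp_coef al))) x
   = RtoC x * (CPSeries (CPS_derive (hyp_coef al)) x
       + RtoC x * CPSeries (CPS_derive (CPS_derive (hyp_coef al))) x)
     + RtoC 2 * al * RtoC x * CPSeries (CPS_derive (hyp_coef al)) x
     + al * al * CPSeries (hyp_coef al) x)%C.
Proof.
  intros Hx.
  destruct (hyp_coef_Cconvergent al) as [HA HB].
  set (A := fun n => Re (hyp_coef al n)) in *; set (B := fun n => Im (hyp_coef al n)) in *.
  assert (Rec := hyp2F1_coef_recurrence al); fold (hyp_coef al) in Rec.
  destruct al as [p q].
  assert (RA : forall n, (INR n + 1) ^ 2 * A (S n)
     = ((INR n + p) ^ 2 - q ^ 2) * A n - 2 * (INR n + p) * q * B n).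
  { intros n; assert (E := f_equal fst (Rec n)); unfold A, B, Re, Im in *; simpl in *; lra. }
  (* The imaginary parts obey the recurrence of the real parts with [A] and [B] exchanged and q
     replaced by -q, so one real lemma yields both halves of the equation. *)
  assert (RB : forall n, (INR n + 1) ^ 2 * B (S n)
     = ((INR n + p) ^ 2 - (- q) ^ 2) * B n - 2 * (INR n + p) * (- q) * A n).
  { intros n; assert (E := f_equal snd (Rec n)); unfold A, B, Re, Im in *; simpl in *; lra. }
  assert (EA := PSeries_hypergeometric_equation A B p q x HA HB Hx RA).
  assert (EB := PSeries_hypergeometric_equation B A p (- q) x HB HA Hx RB).
  assert (S1 : CPSeries (CPS_derive (hyp_coef (p, q))) x
    = (PSeries (PS_derive A) x, PSeries (PS_derive B) x)).
  { unfold CPSeries; f_equal; symmetry; apply PSeries_ext;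
      [apply CPS_derive_Re | apply CPS_derive_Im]. }
  assert (S2 : CPSeries (CPS_derive (CPS_derive (hyp_coef (p, q)))) x
    = (PSeries (PS_derive (PS_derive A)) x, PSeries (PS_derive (PS_derive B)) x)).
  { unfold CPSeries; f_equal; apply PSeries_ext; intros n;
      [rewrite <- CPS_derive_Re | rewrite <- CPS_derive_Im];
      unfold PS_derive at 1 2; f_equal; symmetry;
      [apply CPS_derive_Re | apply CPS_derive_Im]. }
  rewrite S1, S2; change (CPSeries (hyp_coef (p, q)) x) with (PSeries A x, PSeries B x).
  apply injective_projections; simpl; lra.
Qed.

(** * The profile of the Riemann function *)

Lemma is_derive_eq (f : R -> R) (x l l' : R) : is_derive f x l -> l = l' -> is_derive f x l'.
Proof. intros H <-; exact H. Qed.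

Ltac Cderive :=
  repeat match goal with
  | |- is_Cderive (fun _ => (_ + _)%C) _ _ => apply is_Cderive_plus
  | |- is_Cderive (fun _ => (_ * _)%C) _ _ => apply is_Cderive_mult
  | |- is_Cderive (fun _ => ?c) _ _ => apply is_Cderive_const
  | |- _ => eassumption
  end.

(* For [F] solving the hypergeometric equation, [H = (1-z)^al F] solves
   [(1-z)^2 (z H')' = al (al-1) H], whose coefficient is real. *)
Lemma hypergeometric_substitution (al : C) (D k F0 F1 F2 F3 F4 : R -> C) (x : R) :
  is_Cderive F0 x (F1 x) -> is_Cderive F1 x (F2 x) -> is_Cderive F2 x (F3 x) ->
  is_Cderive F3 x (F4 x) -> is_Cderive D x (- al * k x * D x)%C ->
  is_Cderive k x (k x * k x)%C -> ((RtoC 1 - RtoC x) * k x = RtoC 1)%C ->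
  (F1 x + RtoC x * F2 x = RtoC x * (F1 x + RtoC x * F2 x)
     + RtoC 2 * al * RtoC x * F1 x + al * al * F0 x)%C ->
  let H1 := (fun x => D x * (F1 x + (- al) * k x * F0 x))%C in
  let H2 := (fun x => D x * (F2 x + (- (RtoC 2 * al)) * k x * F1 x
        + (al * al - al) * (k x * k x) * F0 x))%C in
  let H3 := (fun x => D x * (F3 x + (- (RtoC 3 * al)) * k x * F2 x
        + RtoC 3 * (al * al - al) * (k x * k x) * F1 x
        + (- (al * (al - RtoC 1) * (al - RtoC 2))) * (k x * k x * k x) * F0 x))%C in
  is_Cderive (fun x => D x * F0 x)%C x (H1 x) /\ is_Cderive H1 x (H2 x) /\
  is_Cderive H2 x (H3 x) /\ (exists l, is_Cderive H3 x l) /\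
  (RtoC ((1 - x) * (1 - x)) * (H1 x + RtoC x * H2 x)
     = - (al * (RtoC 1 - al)) * (D x * F0 x))%C.
Proof.
  (* Numerals are written as sums of 1 so that [ring] can compute with them in C. *)
  assert (two : RtoC 2 = (RtoC 1 + RtoC 1)%C) by (rewrite <- RtoC_plus; f_equal; ring).
  assert (three : RtoC 3 = (RtoC 1 + RtoC 1 + RtoC 1)%C)
    by (rewrite <- !RtoC_plus; f_equal; ring).
  intros d0 d1 d2 d3 dD dk Hk E; cbv zeta.
  rewrite ?two, ?three in *.
  split; [|split; [|split; [|split]]].
  - eapply is_Cderive_eq; [Cderive | cbv beta; ring].
  - eapply is_Cderive_eq; [Cderive | cbv beta; ring].
  - eapply is_Cderive_eq; [Cderive | cbv beta; ring].
  - eexists; Cderive.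
  - rewrite RtoC_mult, RtoC_minus.
    set (y := RtoC x) in *; set (f0 := F0 x) in *; set (f1 := F1 x) in *; set (f2 := F2 x) in *.
    assert (E' : ((RtoC 1 - y) * (f1 + y * f2) = RtoC 2 * al * y * f1 + al * al * f0)%C).
    { transitivity ((f1 + y * f2) - y * (f1 + y * f2))%C; [ring | rewrite E at 1; ring]. }
    (* Every [k x] = 1/(1-x) is paired with a factor 1-x, so that no denominators remain. *)
    transitivity (D x * ((RtoC 1 - y) * ((RtoC 1 - y) * (f1 + y * f2))
       + (RtoC 1 - y) * ((RtoC 1 - y) * k x) * (- al * f0 - RtoC 2 * al * y * f1)
       + ((RtoC 1 - y) * k x) * ((RtoC 1 - y) * k x) * ((al * al - al) * y * f0)))%C; [ring |].
    rewrite Hk, E'; ring.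
Qed.

Lemma legendre_function_derivatives (al : C) :
  exists H1 H2 H3 : R -> C, forall x, Rabs x < 1 ->
    let H := fun x => (Rcpow (1 - x) al * CPSeries (hyp_coef al) x)%C in
    is_Cderive H x (H1 x) /\ is_Cderive H1 x (H2 x) /\ is_Cderive H2 x (H3 x) /\
    (exists l, is_Cderive H3 x l) /\
    (RtoC ((1 - x) * (1 - x)) * (H1 x + RtoC x * H2 x) = - (al * (RtoC 1 - al)) * H x)%C.
Proof.
  assert (C0 := hyp_coef_Cconvergent al).
  assert (C1 := unit_disk_Cconvergent_derive _ C0).
  assert (C2 := unit_disk_Cconvergent_derive _ C1).
  assert (C3 := unit_disk_Cconvergent_derive _ C2).
  do 3 eexists; intros x Hx.
  assert (Hx1 := Hx); apply Rabs_lt_between in Hx1.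
  apply (hypergeometric_substitution al (fun x => Rcpow (1 - x) al)
    (fun x : R => RtoC (/ (1 - x))) _ _ _ _ _ x
    (is_Cderive_CPSeries _ x C0 Hx) (is_Cderive_CPSeries _ x C1 Hx)
    (is_Cderive_CPSeries _ x C2 Hx) (is_Cderive_CPSeries _ x C3 Hx)).
  - apply is_Cderive_Rcpow; lra.
  - rewrite <- RtoC_mult; apply is_Cderive_RtoC; auto_derive; [lra | simpl; field; lra].
  - rewrite <- RtoC_minus, <- RtoC_mult; f_equal; field; lra.
  - apply hypergeometric_equation, Hx.
Qed.

(** At x = 0 both exponents are 0 and the second solution is logarithmic, so a solution
    differentiable up to 0 is determined by y(0). In place of Frobenius theory, (x y')' = -la
    y/(1-x)^2 is integrated twice, and each pass halves a weighted bound for y. *)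
Lemma fuchs_equation_zero (la : R) (y y1 y2 : R -> R) :
  (forall x, 0 <= x < 1 -> is_derive y x (y1 x)) ->
  (forall x, 0 <= x < 1 -> is_derive y1 x (y2 x)) ->
  (forall x, 0 <= x < 1 -> (1 - x) * (1 - x) * (y1 x + x * y2 x) = - la * y x) ->
  y 0 = 0 -> forall x, 0 <= x < 1 -> y x = 0.
Proof.
  intros D D1 E H0 Z HZ.
  (* Bound for the coefficient |la|/(1-x)^2 on [0,Z]; the choice of [k] below then gives L/k <=
     1/2. *)
  set (L := Rabs la / ((1 - Z) * (1 - Z))).
  assert (HL : 0 <= L).
  { apply Rdiv_le_0_compat; [apply Rabs_pos | nra]. }
  set (k := 2 * L + 1).
  assert (Cy : forall x, 0 <= x < 1 -> continuous y x).
  { intros x Hx; apply (ex_derive_continuous (V := R_NormedModule)); eexists; apply D, Hx. }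
  destruct (bounded_continuity (K := R_AbsRing) (V := R_NormedModule) y 0 Z) as [M HM].
  { intros x Hx; apply Cy; lra. }
  assert (HM' : forall x, 0 <= x <= Z -> Rabs (y x) < M) by exact HM.
  assert (HM0 : 0 <= M).
  { assert (h := HM' 0 ltac:(lra)); assert (h' := Rabs_pos (y 0)); lra. }
  assert (Hn : forall n x, 0 <= x <= Z -> Rabs (y x) <= M * (/ 2) ^ n * exp (k * x)).
  { induction n as [|n IH]; intros x Hx.
    - rewrite pow_O, Rmult_1_r.
      assert (h := HM' x Hx); assert (he := exp_ineq1_le (k * x)).
      assert (0 <= k * x) by (apply Rmult_le_pos; unfold k; lra). nra.
    - set (N := M * (/ 2) ^ n) in *.
      assert (HN : 0 <= N) by (apply Rmult_le_pos; [exact HM0 | apply pow_le; lra]).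
      assert (Bode : forall c, 0 <= c <= Z -> Rabs (y1 c + c * y2 c) <= L * N * exp (k * c)).
      { intros c Hc.
        replace (y1 c + c * y2 c) with (- la * y c * / ((1 - c) * (1 - c)))
          by (rewrite <- E by lra; field; lra).
        rewrite !Rabs_mult, Rabs_Ropp, (Rabs_pos_eq (/ _))
          by (apply Rlt_le, Rinv_0_lt_compat; nra).
        replace (L * N * exp (k * c)) with
          (Rabs la * (N * exp (k * c)) * / ((1 - Z) * (1 - Z))) by (unfold L; field; lra).
        apply Rmult_le_compat.
        - apply Rmult_le_pos; apply Rabs_pos.
        - apply Rlt_le, Rinv_0_lt_compat; nra.
        - apply Rmult_le_compat_l; [apply Rabs_pos | apply IH, Hc].
        - apply Rinv_le_contravar; nra. }
      assert (By1 : forall s, 0 <= s <= Z -> Rabs (y1 s) <= L * N * exp (k * s)).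
      { intros s Hs; destruct (Req_dec s 0) as [-> | Hs0].
        - assert (h := Bode 0 ltac:(lra)); rewrite Rmult_0_l, Rplus_0_r in h; exact h.
        - destruct (MVT_gen (fun s => s * y1 s) 0 s (fun s => y1 s + s * y2 s)) as [c [Hc Ec]].
          1,2,3: rewrite ?Rmin_left, ?Rmax_right in * by lra.
          + intros c Hc.
            assert (h := is_derive_mult (K := R_AbsRing) _ _ c _ _
              (is_derive_id (K := R_AbsRing) c) (D1 c ltac:(lra)) (fun n m => Rmult_comm n m)).
            replace (y1 c + c * y2 c) with (plus (mult one (y1 c)) (mult c (y2 c)));
              [exact h | unfold plus, mult, one; simpl; ring].
          + intros c Hc; apply continuity_pt_filterlim.
            apply (continuous_Rmult (U := R_UniformSpace) (fun s => s) y1);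
              [apply continuous_id |].
            apply (ex_derive_continuous (V := R_NormedModule)); eexists; apply D1; lra.
          + cbv beta in Ec.
            assert (Ey : y1 s = y1 c + c * y2 c) by nra.
            rewrite Ey; apply Rle_trans with (1 := Bode c ltac:(lra)).
            apply Rmult_le_compat_l; [apply Rmult_le_pos; assumption |].
            assert (Hle : k * c <= k * s) by (apply Rmult_le_compat_l; unfold k; lra).
            destruct Hle as [Hlt | ->]; [apply Rlt_le, exp_increasing, Hlt | apply Rle_refl]. }
      assert (G := exp_growth_bound y y1 (L * N) k x ltac:(lra) ltac:(nra) ltac:(unfold k; lra)).
      apply Rle_trans with (L * N / k * exp (k * x)).
      + apply G; [intros; apply D; lra | intros; apply Cy; lra | intros; apply By1; lra | exact H0].
      + apply Rmult_le_compat_r; [apply Rlt_le, exp_pos |].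
        simpl; replace (M * (/ 2 * (/ 2) ^ n)) with (N / 2) by (unfold N; field).
        apply Rle_div_l; [unfold k; lra | unfold k; nra]. }
  assert (Hw : Rabs (y Z) <= 0).
  { apply (is_lim_seq_le (fun _ => Rabs (y Z)) (fun n => M * exp (k * Z) * (/ 2) ^ n)
      (Rabs (y Z)) 0).
    - intros n; assert (h := Hn n Z ltac:(lra)); lra.
    - apply is_lim_seq_const.
    - replace (Finite 0) with (Rbar_mult (M * exp (k * Z)) 0) by (simpl; f_equal; ring).
      apply is_lim_seq_scal_l, is_lim_seq_geom; rewrite Rabs_pos_eq; lra. }
  apply Rabs_eq_0; assert (h := Rabs_pos (y Z)); lra.
Qed.

(** Under z = s/(1+s) one has (1-z)^2 d/dz = d/ds and z d/dz = s(1+s) d/ds, so (1-z)^2 (z G')' = -la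
    G becomes (s(1+s) P')' + la P = 0. The half line s >= 0 corresponds to 0 <= z < 1, and P is then
    extended to negative s. *)
Lemma legendre_profile (la : R) (G G1 G2 G3 : R -> R) :
  (forall x, Rabs x < 1 -> is_derive G x (G1 x)) ->
  (forall x, Rabs x < 1 -> is_derive G1 x (G2 x)) ->
  (forall x, Rabs x < 1 -> is_derive G2 x (G3 x)) ->
  (forall x, Rabs x < 1 -> ex_derive G3 x) ->
  (forall x, Rabs x < 1 -> (1 - x) * (1 - x) * (G1 x + x * G2 x) = - la * G x) ->
  G 0 = 1 ->
  exists P P1 P2 P3, is_riemann_profile la P P1 P2 P3 /\
    forall s, 0 <= s -> P s = G (s / (1 + s)).
Proof.
  intros D0 D1 D2 D3 E HG0.
  (* The differentiated equation, the source of the identity for P'''. *)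
  assert (E' : forall x, Rabs x < 1 ->
     - 2 * (1 - x) * (G1 x + x * G2 x) + (1 - x) * (1 - x) * (2 * G2 x + x * G3 x) = - la * G1 x).
  { intros x Hx.
    assert (e1 := is_derive_unique _ _ _ (D1 x Hx)).
    assert (e2 := is_derive_unique _ _ _ (D2 x Hx)).
    assert (e0 := is_derive_unique _ _ _ (D0 x Hx)).
    assert (A : is_derive (fun x => (1 - x) * (1 - x) * (G1 x + x * G2 x)) x
      (- 2 * (1 - x) * (G1 x + x * G2 x) + (1 - x) * (1 - x) * (2 * G2 x + x * G3 x))).
    { auto_derive.
      - repeat split; eexists; [apply D1, Hx | apply D2, Hx].
      - change (Derive (fun x => G1 x) x) with (Derive G1 x);
        change (Derive (fun x => G2 x) x) with (Derive G2 x); rewrite e1, e2; ring. }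
    rewrite <- (is_derive_unique _ _ _ A); apply is_derive_unique.
    apply is_derive_ext_loc with (fun z => - la * G z); [|apply is_derive_scal, D0, Hx].
    assert (Hop : locally x (fun z => Rabs z < 1)).
    { exact (continuous_Rabs x _ (open_lt 1 (Rabs x) Hx)). }
    revert Hop; apply filter_imp; intros z Hz; symmetry; apply E, Hz. }
  assert (Hz : forall s, 0 <= s -> 0 <= s / (1 + s) < 1).
  { intros s Hs; split; [apply Rdiv_le_0_compat; lra | apply Rlt_div_l; lra]. }
  assert (Ha : forall s, 0 <= s -> Rabs (s / (1 + s)) < 1).
  { intros s Hs; assert (h := Hz s Hs); apply Rabs_lt_between; lra. }
  assert (Ch : forall g g' s, 0 <= s -> is_derive g (s / (1 + s)) g' ->
     is_derive (fun s => g (s / (1 + s))) s (/ (1 + s) ^ 2 * g')).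
  { intros g g' s Hs Hg.
    apply (is_derive_comp (K := R_AbsRing) (V := R_NormedModule) g (fun s => s / (1 + s)));
      [exact Hg |].
    auto_derive; [lra | simpl; field; lra]. }
  assert (Pw : forall n s, 0 <= s ->
     is_derive (fun s => / (1 + s) ^ n) s (- INR n * / (1 + s) ^ S n)).
  { intros n s Hs; assert (h : (1 + s) ^ n <> 0) by (apply pow_nonzero; lra).
    auto_derive; [exact h |].
    destruct n as [|n]; [simpl; field; lra |].
    change (pred (S n)) with n; simpl; field; split; [apply pow_nonzero; lra | lra]. }
  assert (Ml : forall u v du dv s, is_derive u s du -> is_derive v s dv ->
     is_derive (fun s => u s * v s) s (du * v s + u s * dv)).
  { intros u v du dv s Hu Hv.
    exact (is_derive_mult (K := R_AbsRing) u v s du dv Hu Hv (fun n m => Rmult_comm n m)). }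
  assert (Pl : forall u v du dv s, is_derive u s du -> is_derive v s dv ->
     is_derive (fun s => u s + v s) s (du + dv)).
  { intros u v du dv s Hu Hv; exact (is_derive_plus (V := R_NormedModule) u v s du dv Hu Hv). }
  assert (Sc : forall u du c s, is_derive u s du -> is_derive (fun s => c * u s) s (c * du)).
  { intros u du c s Hu; apply is_derive_scal, Hu. }
  destruct (C3_extension (fun s => G (s / (1 + s)))
    (fun s => / (1 + s) ^ 2 * G1 (s / (1 + s)))
    (fun s => / (1 + s) ^ 4 * G2 (s / (1 + s)) + - 2 * (/ (1 + s) ^ 3 * G1 (s / (1 + s))))
    (fun s => / (1 + s) ^ 6 * G3 (s / (1 + s)) + - 6 * (/ (1 + s) ^ 5 * G2 (s / (1 + s)))
       + 6 * (/ (1 + s) ^ 4 * G1 (s / (1 + s)))))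
    as (P & P1 & P2 & P3 & A0 & A1 & A2 & A3 & EP).
  - intros s Hs; apply Ch; [exact Hs | apply D0, Ha, Hs].
  - intros s Hs.
    eapply is_derive_eq; [apply Ml; [apply Pw, Hs | apply Ch; [exact Hs | apply D1, Ha, Hs]] |].
    simpl; field; lra.
  - intros s Hs.
    eapply is_derive_eq; [apply Pl; [apply Ml; [apply Pw, Hs | apply Ch; [exact Hs | apply D2, Ha, Hs]]
      | apply Sc, Ml; [apply Pw, Hs | apply Ch; [exact Hs | apply D1, Ha, Hs]]] |].
    simpl; field; lra.
  - intros s Hs; apply (ex_derive_continuous (V := R_NormedModule)).
    destruct (D3 _ (Ha s Hs)) as [G4 D3'].
    eexists; apply Pl; [apply Pl |].
    + apply Ml; [apply Pw, Hs | apply Ch; [exact Hs | exact D3']].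
    + apply Sc, Ml; [apply Pw, Hs | apply Ch; [exact Hs | apply D2, Ha, Hs]].
    + apply Sc, Ml; [apply Pw, Hs | apply Ch; [exact Hs | apply D1, Ha, Hs]].
  - exists P, P1, P2, P3; split; [|intros s Hs; apply EP, Hs].
    split; [exact A0 |]; split; [exact A1 |]; split; [exact A2 |]; split; [exact A3 |].
    split; [|split].
    + transitivity (G (0 / (1 + 0))); [apply EP, Rle_refl |].
      replace (0 / (1 + 0)) with 0 by (field; lra); exact HG0.
    + intros s Hs; destruct (EP s Hs) as (-> & -> & -> & _).
      assert (e := E _ (Ha s Hs)).
      apply Rplus_eq_reg_r with (- la * G (s / (1 + s))); rewrite <- e at 2.
      field; lra.
    + intros s Hs; destruct (EP s Hs) as (_ & -> & -> & ->).
      assert (e := E' _ (Ha s Hs)).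
      apply Rplus_eq_reg_r with (/ (1 + s) ^ 2 * (- la * G1 (s / (1 + s)))); rewrite <- e at 2.
      field; lra.
Qed.

Lemma real_coefficients_parts (r x l : R) (a b c : C) :
  (RtoC r * (a + RtoC x * b) = - RtoC l * c)%C ->
  r * (Re a + x * Re b) = - l * Re c /\ r * (Im a + x * Im b) = - l * Im c.
Proof.
  destruct a, b, c; intros E; split;
    [apply (f_equal fst) in E | apply (f_equal snd) in E]; simpl in *; lra.
Qed.

(** Only the product al(1-al) has to be real: this covers real al as well as al with real part 1/2,
    the case delta < 0. *)
Lemma riemann_profile_exists (al : C) (la : R) :
  (al * (RtoC 1 - al) = RtoC la)%C ->
  exists P P1 P2 P3, is_riemann_profile la P P1 P2 P3 /\
    forall s, 0 <= s ->
      (Rcpow (1 - s / (1 + s)) al * hyp2F1 al al (RtoC 1) (s / (1 + s)) = RtoC (P s))%C.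
Proof.
  intros Hla.
  destruct (legendre_function_derivatives al) as (H1 & H2 & H3 & DH); cbv zeta in DH.
  set (H := fun x => (Rcpow (1 - x) al * CPSeries (hyp_coef al) x)%C) in *.
  assert (Abs : forall x, 0 <= x < 1 -> Rabs x < 1) by (intros; apply Rabs_lt_between; lra).
  assert (HH0 : H 0 = RtoC 1).
  { unfold H, CPSeries; rewrite !PSeries_0.
    unfold Rcpow; rewrite Rminus_0_r, ln_1, Cmult_0_r, Cexp_0.
    unfold hyp_coef, hyp2F1_coef; simpl.
    apply injective_projections; simpl; field. }
  assert (E : forall x, Rabs x < 1 ->
    (RtoC ((1 - x) * (1 - x)) * (H1 x + RtoC x * H2 x) = - RtoC la * H x)%C).
  { intros x Hx; rewrite <- Hla; apply DH, Hx. }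
  assert (EIm : forall x, 0 <= x < 1 -> Im (H x) = 0).
  { apply (fuchs_equation_zero la _ (fun x => Im (H1 x)) (fun x => Im (H2 x))).
    - intros x Hx; apply (DH x (Abs x Hx)).
    - intros x Hx; apply (DH x (Abs x Hx)).
    - intros x Hx.
      exact (proj2 (real_coefficients_parts _ _ _ _ _ _ (E x (Abs x Hx)))).
    - rewrite HH0; reflexivity. }
  assert (D0 : forall x, Rabs x < 1 -> is_derive (fun x => Re (H x)) x (Re (H1 x)))
    by (intros x Hx; apply DH, Hx).
  assert (D1 : forall x, Rabs x < 1 -> is_derive (fun x => Re (H1 x)) x (Re (H2 x)))
    by (intros x Hx; apply DH, Hx).
  assert (D2 : forall x, Rabs x < 1 -> is_derive (fun x => Re (H2 x)) x (Re (H3 x)))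
    by (intros x Hx; apply DH, Hx).
  assert (D3 : forall x, Rabs x < 1 -> ex_derive (fun x => Re (H3 x)) x).
  { intros x Hx; destruct (DH x Hx) as (_ & _ & _ & (l & Hl & _) & _); eexists; exact Hl. }
  assert (ERe : forall x, Rabs x < 1 ->
     (1 - x) * (1 - x) * (Re (H1 x) + x * Re (H2 x)) = - la * Re (H x)).
  { intros x Hx; exact (proj1 (real_coefficients_parts _ _ _ _ _ _ (E x Hx))). }
  assert (G0 : Re (H 0) = 1) by (rewrite HH0; reflexivity).
  destruct (legendre_profile la (fun x => Re (H x)) (fun x => Re (H1 x)) (fun x => Re (H2 x))
    (fun x => Re (H3 x)) D0 D1 D2 D3 ERe G0) as (P & P1 & P2 & P3 & HP & EP).
  exists P, P1, P2, P3; split; [exact HP |].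
  intros s Hs; rewrite EP by exact Hs.
  assert (Hz : 0 <= s / (1 + s) < 1).
  { split; [apply Rdiv_le_0_compat; lra | apply Rlt_div_l; lra]. }
  change (H (s / (1 + s)) = RtoC (Re (H (s / (1 + s))))).
  apply injective_projections; [reflexivity | apply EIm, Hz].
Qed.

(** * The kernels of the representation formula *)

Lemma Csqrt_sqr d : (Csqrt d * Csqrt d = RtoC d)%C.
Proof.
  unfold Csqrt; destruct (Rle_dec 0 d) as [h | h].
  - assert (e := sqrt_sqrt d h); apply injective_projections; simpl; lra.
  - assert (e := sqrt_sqrt (- d) ltac:(lra)); apply injective_projections; simpl; lra.
Qed.

(* Since [1 - z = 4(1+t)(1+b)/D], the powers of [1+t], [1+b] and [D] in [E]
   combine into [2^(sqrt delta) / 2 * (1+t)^(-mu/2) (1+b)^(mu/2) (1-z)^al]. *)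
Lemma kerE_profile mu nu2 t x b y :
  let sd := Csqrt (delta mu nu2) in
  let al := ((RtoC 1 - sd) / RtoC 2)%C in
  let s := ((t - b) ^ 2 - (y - x) ^ 2) / (4 * (1 + t) * (1 + b)) in
  0 < 1 + t -> 0 < 1 + b -> 0 <= s ->
  (kerE t x b y mu nu2 =
   Rcpow 2 sd * RtoC (/ 2 * Rpower (1 + t) (- (mu / 2)) * Rpower (1 + b) (mu / 2))
   * (Rcpow (1 - s / (1 + s)) al * hyp2F1 al al (RtoC 1) (s / (1 + s))))%C.
Proof.
  intros sd al s Ht Hb Hs; unfold kerE; fold sd; fold al.
  set (Dn := (t + b + 2) ^ 2 - (y - x) ^ 2).
  assert (Hm : 0 < 4 * (1 + t) * (1 + b)) by nra.
  assert (HD : Dn = 4 * (1 + t) * (1 + b) * (1 + s)) by (unfold Dn, s; field; lra).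
  assert (HDp : 0 < Dn) by (rewrite HD; nra).
  replace (((t - b) ^ 2 - (y - x) ^ 2) / Dn) with (s / (1 + s)).
  2:{ assert (HN : (t - b) ^ 2 - (y - x) ^ 2 = s * (4 * (1 + t) * (1 + b)))
        by (unfold s; field; lra).
      rewrite HN, HD; clearbody s; field; lra. }
  generalize (hyp2F1 al al (RtoC 1) (s / (1 + s))); intros F.
  replace (1 - s / (1 + s)) with (/ (1 + s)) by (field; lra).
  rewrite !Cmult_assoc; f_equal.
  unfold Rcpow.
  (* With all factors written as exponentials, the claim becomes a linear identity in the logarithms
     of 2, 1+t, 1+b and 1+s. *)
  replace (/ 2 * Rpower (1 + t) (- (mu / 2)) * Rpower (1 + b) (mu / 2))
    with (exp (- ln 2 + - (mu / 2) * ln (1 + t) + mu / 2 * ln (1 + b))).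
  2:{ rewrite !exp_plus, exp_Ropp, exp_ln by lra; reflexivity. }
  rewrite <- Cexp_RtoC, <- !Cexp_plus; f_equal.
  rewrite ln_Rinv by lra.
  rewrite HD, !ln_mult by nra.
  replace 4 with (2 * 2) by ring; rewrite ln_mult by lra.
  generalize (ln (1 + t)) (ln (1 + b)) (ln 2) (ln (1 + s)); intros lt lb l2 ls.
  unfold al; rewrite !RtoC_plus, !RtoC_opp, !RtoC_mult.
  rewrite RtoC_opp, RtoC_div by lra.
  assert (two : RtoC 2 = (RtoC 1 + RtoC 1)%C) by (rewrite <- RtoC_plus; f_equal; ring).
  assert (h2 : RtoC 2 <> RtoC 0) by (apply RtoC_neq_0; lra).
  rewrite two in *; field; exact h2.
Qed.

Lemma kerE_eq mu nu2 P t x b y :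
  let sd := Csqrt (delta mu nu2) in
  let al := ((RtoC 1 - sd) / RtoC 2)%C in
  let s := ((t - b) ^ 2 - (y - x) ^ 2) / (4 * (1 + t) * (1 + b)) in
  (forall s, 0 <= s ->
     (Rcpow (1 - s / (1 + s)) al * hyp2F1 al al (RtoC 1) (s / (1 + s)) = RtoC (P s))%C) ->
  0 < 1 + t -> 0 < 1 + b -> (y - x) ^ 2 <= (t - b) ^ 2 ->
  (kerE t x b y mu nu2 = Rcpow 2 sd *
     RtoC (/ 2 * Rpower (1 + t) (- (mu / 2)) * (Rpower (1 + b) (mu / 2) * P s)))%C.
Proof.
  intros sd al s HP Ht Hb Hyx.
  assert (Hs : 0 <= s) by (apply Rdiv_le_0_compat; [lra | nra]).
  assert (E := kerE_profile mu nu2 t x b y Ht Hb Hs); cbv zeta in E.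
  fold sd in E; fold al in E; fold s in E; rewrite E, (HP s Hs).
  rewrite <- Cmult_assoc, <- RtoC_mult; do 2 f_equal; ring.
Qed.

(** The inequality on y is strict so that s stays nonnegative for b on both sides of 0. On the edge
    itself s would be negative for small b > 0; these two endpoints do not affect the integral. The
    term -mu/2 P comes from the factor (1+b)^(mu/2). *)
Lemma kerK0_eq mu nu2 P P1 t x y :
  let sd := Csqrt (delta mu nu2) in
  let al := ((RtoC 1 - sd) / RtoC 2)%C in
  let s := (t ^ 2 - (y - x) ^ 2) / (4 * (1 + t)) in
  (forall s, 0 <= s ->
     (Rcpow (1 - s / (1 + s)) al * hyp2F1 al al (RtoC 1) (s / (1 + s)) = RtoC (P s))%C) ->
  (forall z, is_derive P z (P1 z)) ->
  0 <= t -> (y - x) ^ 2 < t ^ 2 ->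
  (kerK0 t x y mu nu2 = Rcpow 2 sd *
     RtoC (/ 2 * Rpower (1 + t) (- (mu / 2)) *
       (- P1 s * (((y - x) ^ 2 - 2 * t - t ^ 2) / (4 * (1 + t))) - mu / 2 * P s)))%C.
Proof.
  intros sd al s HP HD Ht Hyx.
  set (R0 := fun b => / 2 * Rpower (1 + t) (- (mu / 2)) * (Rpower (1 + b) (mu / 2)
    * P (((t - b) ^ 2 - (y - x) ^ 2) / (4 * (1 + t) * (1 + b))))).
  assert (Loc : locally 0 (fun b => kerE t x b y mu nu2 = (Rcpow 2 sd * RtoC (R0 b))%C)).
  { assert (L1 : locally 0 (fun b : R => -1 < b)) by (apply (open_gt (-1) 0); lra).
    assert (C : continuous (fun b : R => (t - b) ^ 2) 0).
    { apply (ex_derive_continuous (V := R_NormedModule)); auto_derive; exact I. }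
    assert (L2 : locally 0 (fun b : R => (y - x) ^ 2 < (t - b) ^ 2)).
    { apply (C (fun v => (y - x) ^ 2 < v)), (open_gt ((y - x) ^ 2)).
      rewrite Rminus_0_r; exact Hyx. }
    generalize (filter_and _ _ L1 L2); apply filter_imp; intros b [A B].
    unfold R0; apply (kerE_eq mu nu2 P); [exact HP | lra | lra | lra]. }
  assert (D : is_derive R0 0 (- (/ 2 * Rpower (1 + t) (- (mu / 2)) *
       (- P1 s * (((y - x) ^ 2 - 2 * t - t ^ 2) / (4 * (1 + t))) - mu / 2 * P s)))).
  { unfold R0.
    replace (- (/ 2 * Rpower (1 + t) (- (mu / 2)) *
       (- P1 s * (((y - x) ^ 2 - 2 * t - t ^ 2) / (4 * (1 + t))) - mu / 2 * P s)))
     with (/ 2 * Rpower (1 + t) (- (mu / 2)) * (mu / 2 * P s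
       + 1 * ((((y - x) ^ 2 - 2 * t - t ^ 2) / (4 * (1 + t))) * P1 s))) by ring.
    apply is_derive_scal.
    assert (E0 : s = ((t - 0) ^ 2 - (y - x) ^ 2) / (4 * (1 + t) * (1 + 0)))
      by (unfold s; field; lra).
    assert (Dw : is_derive (fun b => Rpower (1 + b) (mu / 2)) 0 (mu / 2)).
    { unfold Rpower; auto_derive; [lra |].
      rewrite Rplus_0_r, ln_1, Rmult_0_r, exp_0; field. }
    assert (DP : is_derive (fun b => P (((t - b) ^ 2 - (y - x) ^ 2) / (4 * (1 + t) * (1 + b)))) 0
      ((((y - x) ^ 2 - 2 * t - t ^ 2) / (4 * (1 + t))) * P1 s)).
    { rewrite E0.
      apply (is_derive_comp (K := R_AbsRing) (V := R_NormedModule) P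
        (fun b => ((t - b) ^ 2 - (y - x) ^ 2) / (4 * (1 + t) * (1 + b)))); [apply HD |].
      auto_derive; [nra | simpl; field; lra]. }
    assert (M := is_derive_mult (K := R_AbsRing) _ _ 0 _ _ Dw DP (fun n m => Rmult_comm n m)).
    cbv beta in M; rewrite <- E0 in M; rewrite Rplus_0_r in M.
    unfold Rpower at 2 in M; rewrite ln_1, Rmult_0_r, exp_0 in M.
    exact M. }
  set (d := _ - mu / 2 * P s) in *; set (rt := / 2 * Rpower _ _) in *.
  (* [pr] is the real or the imaginary part; on real multiples of a fixed complex number either one
     is multiplication by a constant. *)
  assert (Part : forall (pr : C -> R) (k : R),
    (forall v, pr (Rcpow 2 sd * RtoC v)%C = k * v) ->
    Derive (fun b => pr (kerE t x b y mu nu2)) 0 = k * - (rt * d)).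
  { intros pr k Hpr; apply is_derive_unique.
    apply is_derive_ext_loc with (fun b => k * R0 b); [|apply is_derive_scal, D].
    revert Loc; apply filter_imp; intros b ->; symmetry; apply Hpr. }
  unfold kerK0, CDerive.
  rewrite (Part Re (Re (Rcpow 2 sd))), (Part Im (Im (Rcpow 2 sd)));
    destruct (Rcpow 2 sd) as [c1 c2]; try (intros v; simpl; ring).
  apply injective_projections; simpl; ring.
Qed.

(** Each kernel is the fixed number c = 2^(sqrt delta) times a real function, so the prefactor 1/c
    leaves a real integral; this is why the formula is real also when delta < 0. Agreement on the
    open interval suffices. *)
Lemma CRInt_real (c : C) (g : R -> C) (h : R -> R) (k a b : R) :
  c <> RtoC 0 -> a <= b -> (forall y, continuous h y) ->
  (forall y, a < y < b -> g y = (c * RtoC (k * h y))%C) ->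
  (RtoC 1 / c * CRInt g a b = RtoC (k * RInt h a b))%C.
Proof.
  intros Hc Hab Hh Hg.
  assert (I : is_RInt (V := R_NormedModule) h a b (RInt h a b)).
  { apply (RInt_correct (V := R_CompleteNormedModule)).
    apply (ex_RInt_continuous (V := R_CompleteNormedModule)); intros y _; apply Hh. }
  assert (J : is_RInt (V := C_R_NormedModule) g a b (c * RtoC (k * RInt h a b))%C).
  { apply (is_RInt_ext (fun y => (c * RtoC (k * h y))%C)).
    - rewrite Rmin_left, Rmax_right by lra; intros y Hy; symmetry; apply Hg, Hy.
    - destruct c as [c1 c2].
      replace ((c1, c2) * RtoC (k * RInt h a b))%C
        with ((c1 * k * RInt h a b, c2 * k * RInt h a b) : C)
        by (apply injective_projections; simpl; ring).
      apply (is_RInt_fct_extend_pair (U := R_NormedModule) (V := R_NormedModule)).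
      + apply (is_RInt_ext (fun y => scal (c1 * k) (h y))).
        * intros y _; unfold scal; simpl; unfold mult; simpl; ring.
        * apply (is_RInt_scal (V := R_NormedModule)), I.
      + apply (is_RInt_ext (fun y => scal (c2 * k) (h y))).
        * intros y _; unfold scal; simpl; unfold mult; simpl; ring.
        * apply (is_RInt_scal (V := R_NormedModule)), I. }
  unfold CRInt; rewrite (is_RInt_unique (V := C_R_CompleteNormedModule) _ _ _ _ J).
  field; exact Hc.
Qed.

Theorem theorem1p1 (mu nu2 : R) (f : R -> R -> R) (u0 u1 : R -> R)
  (hmu : 0 <= mu) (hnu2 : 0 <= nu2)
  (hf : is_C01_half f) (hu0 : is_Ck 2 u0) (hu1 : is_Ck 1 u1) :
  exists u : R -> R -> R,
    (forall t x, 0 <= t -> RtoC (u t x) = repr_formula mu nu2 f u0 u1 t x) /\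
    classical_solution mu nu2 f u0 u1 u /\
    (forall v : R -> R -> R, classical_solution mu nu2 f u0 u1 v ->
       forall t x, 0 <= t -> v t x = u t x).
Proof.
  set (sd := Csqrt (delta mu nu2)).
  set (al := ((RtoC 1 - sd) / RtoC 2)%C).
  assert (h2 : RtoC 2 <> RtoC 0) by (apply RtoC_neq_0; lra).
  assert (Hal : (al * (RtoC 1 - al) = RtoC (nu2 + mu / 2 - mu ^ 2 / 4))%C).
  { transitivity ((RtoC 1 - sd * sd) / (RtoC 2 * RtoC 2))%C.
    - unfold al.
      assert (two : RtoC 2 = (RtoC 1 + RtoC 1)%C) by (rewrite <- RtoC_plus; f_equal; ring).
      rewrite two in *; field; exact h2.
    - unfold sd; rewrite Csqrt_sqr, <- RtoC_minus, <- RtoC_mult, <- RtoC_div by lra.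
      f_equal; unfold delta; field. }
  destruct (riemann_profile_exists al _ Hal) as (P & P1 & P2 & P3 & HP & EP).
  destruct (cauchy_existence mu nu2 f u0 u1 P P1 P2 P3 HP hf hu0 hu1)
    as (u & Q & H & w & HS & CQ & CH & Cw & EQ & EH & Ew & Eu).
  exists u; split; [|split; [exact HS |]].
  2:{ intros v Hv t x Ht; apply (classical_solution_unique mu nu2 f u0 u1 u v HS Hv t x Ht). }
  destruct (is_Ck_2 _ hu0) as (D0 & _ & _); destruct (is_Ck_1 _ hu1) as (D1 & _).
  assert (C0 : forall z, continuous u0 z).
  { intros z; apply (ex_derive_continuous (V := R_NormedModule)); eexists; apply D0. }
  assert (C1 : forall z, continuous u1 z).
  { intros z; apply (ex_derive_continuous (V := R_NormedModule)); eexists; apply D1. }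
  assert (Cf := cont2_half_extension f (proj1 hf)).
  intros t x Ht; rewrite Eu by exact Ht.
  set (r := / 2 * Rpower (1 + t) (- (mu / 2))).
  assert (Hc : Rcpow 2 sd <> RtoC 0) by apply Cexp_neq_0.
  assert (I0 : (RtoC 1 / Rcpow 2 sd *
      CRInt (fun y => RtoC (u0 y) * kerK0 t x y mu nu2) (x - t) (x + t)
    = RtoC (r * RInt (fun y => (u0 y * (H t (y - x) 0 - mu / 2 * Q t (y - x) 0))%R)
        (x - t) (x + t)))%C).
  { apply CRInt_real; [exact Hc | lra | intros y; cont |].
    intros y Hy.
    rewrite (kerK0_eq mu nu2 P P1) by (try assumption; try apply HP; nra).
    rewrite EH, EQ by lra; fold sd; fold r.
    replace (((t - 0) ^ 2 - (y - x) ^ 2) / (4 * (1 + t) * (1 + 0)))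
      with ((t ^ 2 - (y - x) ^ 2) / (4 * (1 + t))) by (field; lra).
    rewrite !RtoC_mult; ring. }
  assert (I1 : (RtoC 1 / Rcpow 2 sd *
      CRInt (fun y => RtoC (u1 y + mu * u0 y)%R * kerK1 t x y mu nu2) (x - t) (x + t)
    = RtoC (r * RInt (fun y => ((u1 y + mu * u0 y) * Q t (y - x) 0)%R) (x - t) (x + t)))%C).
  { apply CRInt_real; [exact Hc | lra | intros y; cont |].
    intros y Hy; unfold kerK1.
    rewrite (kerE_eq mu nu2 P) by (try assumption; nra).
    rewrite EQ by lra; fold sd; fold r.
    unfold Rpower at 1; rewrite Rplus_0_r, ln_1, Rmult_0_r, exp_0, Rmult_1_l.
    rewrite !RtoC_mult; ring. }
  assert (I2 : (RtoC 1 / Rcpow 2 sd *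
      CRInt (fun b => CRInt (fun y => RtoC (f b y) * kerE t x b y mu nu2)
        (x - t + b) (x + t - b)) 0 t
    = RtoC (r * duhamel (cone (fun b y => (w b * f (Rmax b 0) y)%R) Q) t x 0))%C).
  { set (g := fun b y => w b * f (Rmax b 0) y).
    assert (Cg : cont2 g).
    { intros U b y p Hb Hy; unfold g; apply continuous_Rmult; [cont | apply Cf; assumption]. }
    assert (CC := cont3_cone g Q Cg CQ).
    unfold duhamel; apply CRInt_real; [exact Hc | lra | intros b; cont |].
    intros b Hb.
    (* The prefactor is consumed by the outer integral; inserting c/c supplies another one for the
       inner integral. *)
    transitivity (Rcpow 2 sd * (RtoC 1 / Rcpow 2 sd *
      CRInt (fun y => RtoC (f b y) * kerE t x b y mu nu2) (x - t + b) (x + t - b)))%C.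
    { field; exact Hc. }
    f_equal; unfold cone.
    replace (x - t + b) with (x - (t - b)) by ring.
    replace (x + t - b) with (x + (t - b)) by ring.
    apply CRInt_real; [exact Hc | lra | intros y; cont |].
    intros y Hy; rewrite (kerE_eq mu nu2 P) by (try assumption; nra).
    rewrite EQ by lra; unfold g; rewrite Ew, Rmax_left by lra; fold sd; fold r.
    rewrite !RtoC_mult; ring. }
  unfold repr_formula; fold sd; cbv zeta; rewrite I0, I1, I2.
  rewrite <- !RtoC_plus; f_equal; fold r.
  (* The -mu/2 [u0] from K_0 and the mu [u0] of the second integral add up to the mu/2 [u0] in the
     initial velocity of v. *)
  assert (S : RInt (fun y => u0 y * (H t (y - x) 0 - mu / 2 * Q t (y - x) 0)) (x - t) (x + t)
     + RInt (fun y => (u1 y + mu * u0 y) * Q t (y - x) 0) (x - t) (x + t)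
     = cone (fun _ => u0) H t x 0 + cone (fun _ y => u1 y + mu / 2 * u0 y) Q t x 0).
  { unfold cone; rewrite !Rminus_0_r.
    assert (X : forall k : R -> R, (forall y, continuous k y) ->
      ex_RInt (V := R_NormedModule) k (x - t) (x + t)).
    { intros k Hk; apply (ex_RInt_continuous (V := R_CompleteNormedModule)); intros; apply Hk. }
    assert (Pl : forall k1 k2 : R -> R, (forall y, continuous k1 y) -> (forall y, continuous k2 y) ->
      RInt k1 (x - t) (x + t) + RInt k2 (x - t) (x + t)
      = RInt (fun y => k1 y + k2 y) (x - t) (x + t)).
    { intros k1 k2 Hk1 Hk2; symmetry.
      apply (RInt_plus (V := R_CompleteNormedModule) k1 k2); apply X; assumption. }
    rewrite !Pl by (intros y; cont).
    apply RInt_ext; intros y _; match goal with |- ?a = ?b => change (@eq R a b); field end. }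
  transitivity (r * (u0 (x + t) + u0 (x - t)) +
    r * (cone (fun _ => u0) H t x 0 + cone (fun _ y => u1 y + mu / 2 * u0 y) Q t x 0)
    + r * duhamel (cone (fun b y => w b * f (Rmax b 0) y) Q) t x 0); [ring |].
  rewrite <- S; ring.
Qed.
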